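(* Let $m\in L^\infty(\mathbb T^2;\mathbb R^2)$ satisfy $|m|=1$ almost everywhere and $$\mathcal K_m=\{e\in H:e\cdot m=0\}=\{0\}.$$ Then, for every $\eta>0$, there exists $C_\eta<\infty$ such that $$|e|^2\le C_\eta|e\cdot m|^2+\eta\|e\|^2,\qquad e\in V .$$
   Context: $\mathbb T^2=(\mathbb R/2\pi\mathbb Z)^2$. $H$ is the space of divergence-free, mean-zero fields in $L^2(\mathbb T^2)^2$, and $V=H^1(\mathbb T^2)^2\cap H$. $|\cdot|$ is the $L^2$ norm (of scalars or vector fields) and $\|e\|=\|\nabla e\|_{L^2}$ for $e\in V$. *)

(* Defs.v *)
From HB Require Import structures.
From mathcomp Require Import all_boot all_order all_algebra.
From mathcomp Require Import all_classical all_reals all_analysis.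

Set Implicit Arguments.
Unset Strict Implicit.
Unset Printing Implicit Defensive.

Import Order.TTheory GRing.Theory Num.Theory.
Import numFieldNormedType.Exports.
Local Open Scope classical_set_scope.
Local Open Scope ring_scope.

Section Torus.
Context {R : realType}.

(* A function on the torus (R / 2 pi Z)^2 is a function on R^2 that is
   2 pi-periodic in each variable.  Elements of Lebesgue spaces are handled
   through such representatives; two of them are identified when they agree
   almost everywhere. *)
Definition torus_periodic (T : Type) (f : R * R -> T) : Prop :=
  forall x, f (x.1 + 2 * pi, x.2) = f x /\ f (x.1, x.2 + 2 * pi) = f x.

Definition plane_measure :
    {measure set (measurableTypeR R * measurableTypeR R) -> \bar R} :=
  (@lebesgue_measure R \x @lebesgue_measure R)%E.

Definition cell : set (measurableTypeR R * measurableTypeR R) :=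
  `[0, 2 * pi[ `*` `[0, 2 * pi[.

Lemma measurable_cell : measurable cell.
Proof. by apply: measurableX; exact: measurable_itv. Qed.

(* Integrating a periodic function over the torus is integrating it over the
   fundamental cell [0, 2 pi)^2; the measure is not normalized. *)
Definition torus_measure :
    {measure set (measurableTypeR R * measurableTypeR R) -> \bar R} :=
  mrestr plane_measure measurable_cell.

Local Notation mu := torus_measure.

(* The library norms on row vectors and matrices are sup norms, hence this
   Euclidean one (Hilbert-Schmidt on matrices). *)
Definition euclid (p q : nat) (A : 'M[R]_(p, q)) : R :=
  Num.sqrt (\sum_i \sum_j A i j ^+ 2).

Definition dot (u v : 'rV[R]_2) : R := \sum_i u 0 i * v 0 i.

Definition component (v : R * R -> 'rV[R]_2) (i : 'I_2) : R * R -> R :=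
  fun x => v x 0 i.

Definition L2 (f : R * R -> R) : Prop := torus_periodic f /\ f \in Lfun mu 2.

Definition Linfty (f : R * R -> R) : Prop := torus_periodic f /\ f \in Lfun mu +oo%E.

Definition L2norm (f : R * R -> R) : R := fine 'N[mu]_2[EFin \o f]%E.

Definition dir (i : 'I_2) : R * R := if i == 0 then (1, 0) else (0, 1).

(* Continuity of all partial derivatives of order n, existence of all those of
   lower order; requiring this for every n defines C^infinity. *)
Fixpoint Cn (n : nat) (f : R * R -> R) : Prop :=
  if n is k.+1 then
    forall i, (forall x, derivable f x (dir i)) /\ Cn k ('D_(dir i) f)
  else continuous f.

Definition test_function (phi : R * R -> R) : Prop :=
  torus_periodic phi /\ forall n, Cn n phi.

Definition is_weak_partial (i : 'I_2) (f g : R * R -> R) : Prop :=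
  forall phi, test_function phi ->
    \int[mu]_x (f x * 'D_(dir i) phi x) = - \int[mu]_x (g x * phi x).

Definition H1 (f : R * R -> R) : Prop :=
  L2 f /\ forall i, exists g, L2 g /\ is_weak_partial i f g.

(* For f in H1, a representative of the weak partial derivative; it is unique
   up to almost everywhere equality. *)
Definition weak_partial (i : 'I_2) (f : R * R -> R) : R * R -> R :=
  xget (cst 0 : R * R -> R) [set g | L2 g /\ is_weak_partial i f g].

Definition divergence_free (e : R * R -> 'rV[R]_2) : Prop :=
  forall phi, test_function phi ->
    \int[mu]_x (\sum_i component e i x * 'D_(dir i) phi x) = 0.

Definition mean_zero (e : R * R -> 'rV[R]_2) : Prop :=
  forall i, \int[mu]_x component e i x = 0.

Definition spaceH : set (R * R -> 'rV[R]_2) :=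
  [set e | (forall i, L2 (component e i)) /\ divergence_free e /\ mean_zero e].

Definition spaceV : set (R * R -> 'rV[R]_2) :=
  [set e | forall i, H1 (component e i)] `&` spaceH.

Definition weak_grad (e : R * R -> 'rV[R]_2) (x : R * R) : 'M[R]_2 :=
  \matrix_(i, j) weak_partial j (component e i) x.

Definition Vnorm (e : R * R -> 'rV[R]_2) : R :=
  L2norm (fun x => euclid (weak_grad e x)).

Definition spaceK (m : R * R -> 'rV[R]_2) : set (R * R -> 'rV[R]_2) :=
  [set e | spaceH e /\ {ae mu, forall x, dot (e x) (m x) = 0}].

End Torus.

(* Main.v *)
Require Import Defs.
From mathcomp Require Import all_boot all_order all_algebra.
From mathcomp Require Import all_classical all_reals all_analysis.
From mathcomp Require Import measurable_realfun zify lra ring.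

Set Implicit Arguments.
Unset Strict Implicit.
Unset Printing Implicit Defensive.

Import Order.TTheory GRing.Theory Num.Theory.
Import numFieldNormedType.Exports.
Local Open Scope classical_set_scope.
Local Open Scope ring_scope.

(** The estimate says that a field [e] with small component along [m] and
    bounded gradient must be small.  The classical argument is by compactness:
    a violating sequence, normalized in L2, would converge strongly to a
    nonzero element of K_m.  The proof below replaces the extraction of
    subsequences by two density statements in the Hilbert space of square
    integrable fields, both of them instances of the projection theorem
    ([dense_of_perp0]).

    First, frequencies.  Let b_k be the orthonormal family of fields obtained
    from cas(k.x) = cos(k.x) + sin(k.x), k in Z^2, placed in either component.
    It is total ([vmode_total]) because an integrable function on the torus
    without Fourier coefficients vanishes ([torus_uniqueness]).  Since cas is
    turned by differentiation into a multiple of itself at the opposite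
    frequency, Bessel's inequality for the weak gradient bounds the part of e
    of frequency larger than N by N^-2 ||e||^2, whence ([low_frequency])
      |e|^2 <= sum over the finitely many |k| <= N of <e, b_k>^2
               + (N+1)^-2 ||e||^2.

    Second, each single coefficient.  The fields of the form psi m + h, with psi
    in L2 and h orthogonal to H, are dense in L2: a field r orthogonal to all
    of them belongs to H (gradients of test functions and constants are
    among the h) and satisfies r.m = 0 (take psi = r.m), so r lies in K_m = 0.
    Approximating b_k by psi m + h within eps gives, for e in H,
      <e, b_k> = <e.m, psi> + <e, b_k - psi m - h>,
    hence <e, b_k>^2 <= C |e.m|^2 + eps |e|^2 ([control_pairing]).

    Choosing N with (N+1)^-2 <= eta / 2, and then eps so small that the finitely
    many terms eps |e|^2 add up to at most |e|^2 / 2, the latter is absorbed in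
    the left-hand side. *)

(** * Projection and Bessel inequality in a Hilbert space *)

(** The scalar product is semi-definite, and is
    carried by a subset of an ambient module: fields are functions, and those
    equal almost everywhere are not identified. *)
Record hilbert (R : realType) (V : lmodType R) (E : set V) (ip : V -> V -> R)
    : Prop := Hilbert {
  hilbert0 : E 0;
  hilbertP : forall a u v, E u -> E v -> E (a *: u + v);
  ipC : forall u v, E u -> E v -> ip u v = ip v u;
  ip_linl : forall a u v w, E u -> E v -> E w ->
    ip (a *: u + v) w = a * ip u w + ip v w;
  ip_ge0 : forall u, E u -> 0 <= ip u u;
  hilbert_complete : forall u : nat -> V, (forall n, E (u n)) ->
    (forall eps, 0 < eps -> exists N, forall m n, (N <= m)%N -> (N <= n)%N ->
      ip (u m - u n) (u m - u n) <= eps) ->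
    exists2 l, E l & forall eps, 0 < eps -> exists N, forall n, (N <= n)%N ->
      ip (u n - l) (u n - l) <= eps }.

Section Hilbert.
Context {R : realType} {V : lmodType R} {E : set V} {ip : V -> V -> R}.
Hypothesis hE : hilbert E ip.

Local Notation q u := (ip u u).

Lemma hilbertD u v : E u -> E v -> E (u + v).
Proof. by move=> Eu Ev; rewrite -[u]scale1r; exact: hilbertP hE _ _ _ Eu Ev. Qed.

Lemma hilbertZ a u : E u -> E (a *: u).
Proof.
by move=> Eu; rewrite -[_ *: _]addr0; apply: (hilbertP hE) => //; exact: hilbert0 hE.
Qed.

Lemma hilbertN u : E u -> E (- u).
Proof. by rewrite -scaleN1r; exact: hilbertZ. Qed.

Lemma hilbertB u v : E u -> E v -> E (u - v).
Proof. by move=> Eu Ev; apply: hilbertD => //; exact: hilbertN. Qed.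

Lemma ipDl u v w : E u -> E v -> E w -> ip (u + v) w = ip u w + ip v w.
Proof. by move=> Eu Ev Ew; rewrite -[u in LHS]scale1r (ip_linl hE)// mul1r. Qed.

Lemma ip0l w : E w -> ip 0 w = 0.
Proof.
move=> Ew; have E0 := hilbert0 hE.
by apply/(addrI (ip 0 w)); rewrite -ipDl// !addr0.
Qed.

Lemma ipZl a u w : E u -> E w -> ip (a *: u) w = a * ip u w.
Proof.
move=> Eu Ew; rewrite -[a *: u]addr0 (ip_linl hE) ?ip0l ?addr0//.
exact: hilbert0 hE.
Qed.

Lemma ipBl u v w : E u -> E v -> E w -> ip (u - v) w = ip u w - ip v w.
Proof.
move=> Eu Ev Ew; rewrite ipDl//; last exact: hilbertN.
by rewrite -scaleN1r ipZl// mulN1r.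
Qed.

Lemma ipDr u v w : E u -> E v -> E w -> ip w (u + v) = ip w u + ip w v.
Proof.
move=> Eu Ev Ew; rewrite (ipC hE) ?ipDl ?(ipC hE Ew)//; exact: hilbertD.
Qed.

Lemma ipZr a u w : E u -> E w -> ip w (a *: u) = a * ip w u.
Proof.
by move=> Eu Ew; rewrite (ipC hE) ?ipZl ?(ipC hE Ew)//; exact: hilbertZ.
Qed.

Lemma ipBr u v w : E u -> E v -> E w -> ip w (u - v) = ip w u - ip w v.
Proof.
move=> Eu Ev Ew; rewrite (ipC hE) ?ipBl ?(ipC hE Ew)//; exact: hilbertB.
Qed.

Lemma hilbert_sum (I : Type) (s : seq I) (a : I -> R) (b : I -> V) :
  (forall k, E (b k)) -> E (\sum_(k <- s) a k *: b k).
Proof.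
move=> Eb; elim/big_rec : _ => [|k u _ Eu]; first exact: hilbert0 hE.
exact: hilbertP hE _ _ _ (Eb k) Eu.
Qed.

Lemma ip_suml (I : Type) (s : seq I) (a : I -> R) (b : I -> V) w :
  (forall k, E (b k)) -> E w ->
  ip (\sum_(k <- s) a k *: b k) w = \sum_(k <- s) a k * ip (b k) w.
Proof.
move=> Eb Ew; elim: s => [|k s IH]; first by rewrite !big_nil ip0l.
by rewrite !big_cons (ip_linl hE) ?IH//; exact: hilbert_sum.
Qed.

Lemma sqB u v : E u -> E v -> q (u - v) = q u - ip u v *+ 2 + q v.
Proof.
move=> Eu Ev; have EB := hilbertB Eu Ev.
rewrite ipBl// !ipBr// (ipC hE Ev Eu); ring.
Qed.

Lemma sqD u v : E u -> E v -> q (u + v) = q u + ip u v *+ 2 + q v.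
Proof.
move=> Eu Ev; have EB := hilbertD Eu Ev.
rewrite ipDl// !ipDr// (ipC hE Ev Eu); ring.
Qed.

Lemma sqZ a u : E u -> q (a *: u) = a ^+ 2 * q u.
Proof. by move=> Eu; rewrite ipZl ?ipZr ?mulrA//; exact: hilbertZ. Qed.

(** Nonnegativity of q (u - v); it stands in for Cauchy-Schwarz wherever
    constants do not matter. *)
Lemma young u v : E u -> E v -> ip u v *+ 2 <= q u + q v.
Proof.
by move=> Eu Ev; have := ip_ge0 hE (hilbertB Eu Ev); rewrite sqB//; lra.
Qed.

Lemma sqD_le u v : E u -> E v -> q (u + v) <= 2 * q u + 2 * q v.
Proof. by move=> Eu Ev; rewrite sqD//; have := young Eu Ev; lra. Qed.

Lemma cauchy_schwarz u v : E u -> E v -> ip u v ^+ 2 <= q u * q v.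
Proof.
move=> Eu Ev; have qu := ip_ge0 hE Eu; have qv := ip_ge0 hE Ev.
have key t : 2 * t * ip u v <= q u + t ^+ 2 * q v.
  have := young Eu (hilbertZ t Ev); rewrite sqZ// ipZr//; lra.
have [v0|v0] := eqVneq (q v) 0.
  have [->|p0] := eqVneq (ip u v) 0; first by rewrite expr0n v0 mulr0.
  have := key ((q u + 1) / ip u v).
  by rewrite v0 mulr0 addr0 -mulrA divfK//; lra.
have {}qv : 0 < q v by rewrite lt_neqAle eq_sym v0.
have := key (ip u v / q v); rewrite -(ler_pM2r qv) => h.
have e1 : 2 * (ip u v / q v) * ip u v * q v = 2 * ip u v ^+ 2 by field.
have e2 : (q u + (ip u v / q v) ^+ 2 * q v) * q v = q u * q v + ip u v ^+ 2 by field.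
by move: h; rewrite e1 e2; lra.
Qed.

Section Projection.
Variable Y : set V.
Hypotheses (YE : Y `<=` E) (Y0 : Y 0).
Hypothesis YP : forall a u v, Y u -> Y v -> Y (a *: u + v).

(** Minimizing sequences for the distance from [phi] to [Y] are Cauchy by the
    parallelogram identity; [r] is [phi] minus their limit, which elements of [Y]
    approximate. *)
Lemma projection phi : E phi -> exists r, [/\ E r, forall y, Y y -> ip r y = 0 &
  forall delta, 0 < delta -> exists2 y, Y y & q (phi - y - r) <= delta].
Proof.
move=> Ephi.
pose S := [set q (phi - y) | y in Y].
have S0 : lbound S 0.
  by move=> _ [y Yy <-]; apply: (ip_ge0 hE); apply: hilbertB => //; exact: YE.
have hS : has_inf S by split; [exists (q (phi - 0)), 0|exists 0].
pose D := inf S.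
have D_le y : Y y -> D <= q (phi - y) by move=> Yy; apply: ge_inf; [case: hS|exists y].
have [a_ a0 small] : exists2 a_ : nat -> R, (forall n, 0 < a_ n) &
    forall eps, 0 < eps -> exists N, forall n, (N <= n)%N -> a_ n <= eps.
  exists (fun n => n.+1%:R^-1) => [n|eps e0]; first by rewrite invr_gt0 ltr0n.
  exists (Num.Def.trunc eps^-1) => n Nn.
  rewrite -[leRHS]invrK lef_pV2 ?posrE ?invr_gt0 ?ltr0n//.
  by apply: le_trans (ltW (Num.Theory.truncnS_gt _)) _; rewrite ler_nat.
have /choice[y_ Hy] n : exists y, Y y /\ q (phi - y) <= D + a_ n.
  by have [_ [y Yy <-] /ltW ?] := inf_adherent (a0 n) hS; exists y.
have Yy n := (Hy n).1.
have Ey n := YE (Yy n).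
(* Parallelogram identity applied to phi - y_m and phi - y_n: their mean is
   phi minus an element of Y, hence at squared distance at least D. *)
have qY m n : q (y_ m - y_ n) <= 2 * a_ m + 2 * a_ n.
  have hm := (Hy m).2; have hn := (Hy n).2.
  have Eu := hilbertB Ephi (Ey m); have Ev := hilbertB Ephi (Ey n).
  have /D_le : Y (2^-1 *: y_ m + 2^-1 *: y_ n).
    by apply: YP => //; rewrite -[_ *: _]addr0; exact: YP.
  have -> : phi - (2^-1 *: y_ m + 2^-1 *: y_ n) = 2^-1 *: ((phi - y_ m) + (phi - y_ n)).
    rewrite scalerDr !scalerBr addrACA -opprD -scalerDl.
    by rewrite (_ : 2^-1 + 2^-1 = 1 :> R) ?scale1r//; lra.
  rewrite sqZ; last exact: hilbertD.
  rewrite (sqD Eu Ev).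
  have -> : y_ m - y_ n = (phi - y_ n) - (phi - y_ m).
    by rewrite opprB [RHS]addrC addrA subrK.
  rewrite (sqB Ev Eu) (ipC hE Ev Eu); lra.
have [l El ly] : exists2 l, E l & forall eps, 0 < eps ->
    exists N, forall n, (N <= n)%N -> q (y_ n - l) <= eps.
  apply: (hilbert_complete hE) => // eps e0.
  have [N NP] := small (eps / 4) ltac:(lra).
  exists N => m n Nm Nn; apply: le_trans (qY m n) _.
  have := NP _ Nm; have := NP _ Nn; lra.
have Er := hilbertB Ephi El.
exists (phi - l); split => //; last first.
  move=> d d0; have [N NP] := ly _ d0; exists (y_ N) => //.
  have -> : phi - y_ N - (phi - l) = - (y_ N - l) by by rewrite opprB addrC -addrA addKr opprB.
  rewrite -scaleN1r sqZ ?expr2 ?mulN1r ?opprK ?mul1r ?NP//; exact: hilbertB.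
(* First-order optimality along y, transported from y_n to the limit l. *)
have main y t : Y y -> 2 * t * ip (phi - l) y <= 2 * t ^+ 2 * q y.
  move=> Yy'; have Ey' := YE Yy'.
  apply/ler_addgt0Pr => eps e0.
  have [N1 N1P] := small (eps / 2) ltac:(lra).
  have [N2 N2P] := ly (eps / 2) ltac:(lra).
  pose n := maxn N1 N2.
  have h1 := N1P n (leq_maxl _ _); have h2 := N2P n (leq_maxr _ _).
  have h3 := (Hy n).2.
  have Eu := hilbertB Ephi (Ey n); have Ea := hilbertB (Ey n) El.
  have : Y (t *: y + y_ n) by exact: YP.
  move/D_le; rewrite opprD [- _ - _]addrC addrA (sqB Eu (hilbertZ t Ey')).
  rewrite ipZr// sqZ//.
  have := young Ea (hilbertZ t Ey'); rewrite ipZr// sqZ//.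
  have -> : phi - l = (phi - y_ n) + (y_ n - l) by rewrite addrA subrK.
  rewrite (ipDl Eu Ea Ey'); lra.
have le0 y : Y y -> ip (phi - l) y <= 0.
  move=> Yy'; have qy := ip_ge0 hE (YE Yy').
  rewrite leNgt; apply/negP => p0.
  (* A step t < <phi - l, y> / q y contradicts optimality; adding 1 to q y
     avoids the division by zero allowed by semi-definiteness. *)
  have := main y (ip (phi - l) y / (2 * (q y + 1))) Yy'.
  set p := ip _ _ in p0 *; set c := q y in qy *.
  have c1 : 0 < c + 1 by lra.
  rewrite -subr_ge0.
  have -> : 2 * (p / (2 * (c + 1))) ^+ 2 * c - 2 * (p / (2 * (c + 1))) * p =
     - (p ^+ 2 * (c + 2) / (2 * (c + 1) ^+ 2)).
    by field; rewrite gt_eqF//.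
  rewrite oppr_ge0 leNgt => /negP; apply.
  by rewrite divr_gt0// mulr_gt0// ?exprn_gt0//; lra.
move=> y Yy'; apply/eqP; rewrite eq_le le0//=.
have : Y (- y) by rewrite -scaleN1r -[_ *: _]addr0; exact: YP.
by move/le0; rewrite -[- y]scaleN1r ipZr ?mulN1r ?oppr_le0//; exact: YE.
Qed.

Lemma dense_of_perp0 : (forall r, E r -> (forall y, Y y -> ip r y = 0) -> q r = 0) ->
  forall phi delta, E phi -> 0 < delta -> exists2 y, Y y & q (phi - y) <= delta.
Proof.
move=> perp0 phi d Ephi d0; have [r [Er rY rlim]] := projection Ephi.
have [y Yy yd] := rlim (d / 2) ltac:(lra); exists y => //.
have Ey := YE Yy.
have -> : phi - y = (phi - y - r) + r by rewrite subrK.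
apply: le_trans (sqD_le _ _) _ => //; first by apply: hilbertB => //; exact: hilbertB.
rewrite (perp0 r)//; lra.
Qed.

End Projection.

Section Orthonormal.
Context {I : eqType} (b : I -> V).
Hypothesis Eb : forall k, E (b k).
Hypothesis ortho : forall k l, ip (b k) (b l) = (k == l)%:R.

Let P s e := \sum_(k <- s) ip e (b k) *: b k.

Let ip_P s e l : uniq s -> l \in s -> E e -> ip (P s e) (b l) = ip e (b l).
Proof.
move=> us ls Ee; rewrite ip_suml// (bigD1_seq l)//= ortho eqxx mulr1.
by rewrite big1 ?addr0// => k kl; rewrite ortho (negbTE kl) mulr0.
Qed.

Lemma pythagoras s e : uniq s -> E e ->
  q (e - P s e) = q e - \sum_(k <- s) ip e (b k) ^+ 2.
Proof.
move=> us Ee; have EP : E (P s e) by exact: hilbert_sum.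
have e1 : ip e (P s e) = \sum_(k <- s) ip e (b k) ^+ 2.
  rewrite (ipC hE)// ip_suml//; apply: eq_bigr => k _.
  by rewrite (ipC hE (Eb k)) ?expr2.
have e2 : q (P s e) = \sum_(k <- s) ip e (b k) ^+ 2.
  rewrite [X in ip X _]/P ip_suml//; apply: eq_big_seq => k ks.
  by rewrite (ipC hE (Eb k))// ip_P// expr2.
rewrite sqB// e1 e2; ring.
Qed.

Lemma bessel s e : uniq s -> E e -> \sum_(k <- s) ip e (b k) ^+ 2 <= q e.
Proof.
move=> us Ee; rewrite -subr_ge0 -pythagoras//.
by apply: (ip_ge0 hE); apply: hilbertB => //; exact: hilbert_sum.
Qed.

Hypothesis total : forall e, E e -> (forall k, ip e (b k) = 0) -> q e = 0.

(** A quantitative Parseval inequality free of infinite sums: density of the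
    space of all vectors that are orthogonal to every [v] with vanishing
    coefficients on some finite set of indices.  This space contains the finite
    combinations of the [b k], and closure under addition is just concatenation
    of index sets. *)
Lemma parseval_approx e delta : E e -> 0 < delta ->
  exists2 s, uniq s & q e <= \sum_(k <- s) ip e (b k) ^+ 2 + delta.
Proof.
move=> Ee d0.
pose Y : set V := [set y | E y /\ exists s : seq I, forall v, E v ->
  (forall k, k \in s -> ip v (b k) = 0) -> ip v y = 0].
have [] := @dense_of_perp0 Y _ _ _ _ e delta Ee d0.
- by move=> y [].
- split; first exact: hilbert0 hE.
  by exists [::] => v Ev _; rewrite (ipC hE) ?ip0l//; exact: hilbert0 hE.
- move=> a u v [Eu [s su]] [Ev [s' sv]]; split; first exact: hilbertP hE _ _ _ _ _.
  exists (s ++ s') => w Ew w0; rewrite ipDr//; last exact: hilbertZ.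
  by rewrite ipZr// su ?sv ?mulr0 ?addr0// => k ks; apply: w0;
    rewrite mem_cat ks ?orbT.
- move=> r Er rY; apply: total => // k; apply: rY; split => //.
  by exists [:: k] => v Ev; apply; rewrite mem_head.
move=> y [Ey [s sy]] yd; exists (undup s); first exact: undup_uniq.
have EP : E (P (undup s) e) by exact: hilbert_sum.
have Ew := hilbertB Ee EP.
have w0 k : k \in s -> ip (e - P (undup s) e) (b k) = 0.
  by move=> ks; rewrite ipBl// ip_P ?subrr ?undup_uniq ?mem_undup.
have wP : ip (e - P (undup s) e) (P (undup s) e) = 0.
  rewrite (ipC hE)// ip_suml// big_seq big1// => k; rewrite mem_undup => ks.
  by rewrite (ipC hE (Eb k) Ew) w0 ?mulr0.
(* The remainder is orthogonal to both y and the partial sum. *)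
have : q (e - P (undup s) e) <= delta.
  have we : ip (e - P (undup s) e) (e - y) = q (e - P (undup s) e).
    by rewrite !ipBr// wP (sy _ Ew w0).
  have := young Ew (hilbertB Ee Ey); rewrite we; lra.
rewrite pythagoras ?undup_uniq//; lra.
Qed.

End Orthonormal.
End Hilbert.

(** * Square integrable functions and completeness *)

Section SquareIntegrable.
Context d {T : measurableType d} {R : realType} {mu : {measure set T -> \bar R}}.
Implicit Types f g : T -> R.

Lemma Lfun2_measurable f : f \in Lfun mu 2%:E -> measurable_fun setT f.
Proof. by rewrite inE => /andP[]; rewrite inE. Qed.

Lemma Lfun2P f : f \in Lfun mu 2%:E <->
  measurable_fun setT f /\ (\int[mu]_x ((f x) ^+ 2)%:E < +oo)%E.
Proof.
split=> [f2|[mf f2]].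
  split; first exact: Lfun2_measurable.
  have /integrableP[_] := Lfun2_integrable_sqr f2; apply: le_lt_trans.
  apply: ge0_le_integral => //.
  - by move=> x _; rewrite lee_fin sqr_ge0.
  - by apply/measurable_EFinP; apply: measurable_funX; exact: Lfun2_measurable.
  - apply: measurableT_comp => //.
    by apply/measurable_EFinP; apply: measurable_funX; exact: Lfun2_measurable.
  - by move=> x _ /=; rewrite lee_fin ler_norm.
rewrite inE; apply/andP; split; rewrite inE//= /finite_norm unlock /Lnorm.
apply: poweR_lty => /=.
by under eq_integral => x _ do rewrite /= powR_mulrn// real_normK ?num_real//.
Qed.

Lemma Lfun2M_integrable f g : f \in Lfun mu 2%:E -> g \in Lfun mu 2%:E ->
  mu.-integrable setT (EFin \o (fun x => f x * g x)).
Proof. by move=> f2 g2; apply/Lfun1_integrable; exact: Lfun2_mul_Lfun1. Qed.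

Lemma Lfun2_lin a f g : f \in Lfun mu 2%:E -> g \in Lfun mu 2%:E ->
  (fun x => a * f x + g x) \in Lfun mu 2%:E.
Proof. by have [_] := Lfun_submod_closed mu (lee1n 2); exact. Qed.

Lemma Lfun2B f g : f \in Lfun mu 2%:E -> g \in Lfun mu 2%:E ->
  (fun x => f x - g x) \in Lfun mu 2%:E.
Proof.
move=> f2 g2; rewrite (_ : (fun _ => _) = (fun x => -1 * g x + f x)).
  exact: Lfun2_lin.
by apply/funext => x; rewrite mulN1r addrC.
Qed.

(** Stated with an almost everywhere bound because, for the components of a unit
    field, the bound comes from a condition that holds almost everywhere. *)
Lemma Lfun2_bounded_mul f g (M : R) : measurable_fun setT g ->
  {ae mu, forall x, `|g x| <= M} -> f \in Lfun mu 2%:E ->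
  (fun x => f x * g x) \in Lfun mu 2%:E.
Proof.
move=> mg gM f2; have mf := Lfun2_measurable f2.
apply/Lfun2P; split; first exact: measurable_funM.
have := (Lfun2P _).1 (Lfun_scale M (lee1n 2) f2).
case=> mMf; apply: le_lt_trans.
apply: ae_ge0_le_integral => //.
- by move=> x _; rewrite lee_fin sqr_ge0.
- by apply/measurable_EFinP; apply: measurable_funX; exact: measurable_funM.
- by move=> x _; rewrite lee_fin sqr_ge0.
- by apply/measurable_EFinP; apply: measurable_funX.
apply: filterS gM => x gM _; rewrite lee_fin /= !exprMn ler_wpM2l ?sqr_ge0//.
by rewrite -[X in X <= _]real_normK ?num_real// lerXn2r ?nnegrE// (le_trans _ gM).
Qed.

Lemma sqr_Lnorm2 f : f \in Lfun mu 2%:E ->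
  (fine 'N[mu]_2%:E[EFin \o f]%E) ^+ 2 = \int[mu]_x (f x ^+ 2).
Proof.
move=> f2; have := Lnorm_ge0 mu 2%:E (EFin \o f).
have : ('N[mu]_2%:E[EFin \o f] < +oo)%E.
  by move: f2; rewrite inE => /andP[_]; rewrite inE.
have := @powR_Lnorm _ _ _ mu (EFin \o f) 2 ltac:(by rewrite pnatr_eq0).
case: ('N[mu]_2%:E[EFin \o f]%E) => //= r e _; rewrite lee_fin => r0.
rewrite -powR_mulrn// /Rintegral -[LHS]/(fine (r `^ 2)%:E) e.
congr fine; apply: eq_integral => x _.
by rewrite /= powR_mulrn// real_normK ?num_real.
Qed.

Lemma Rintegral_sqr_fin f : f \in Lfun mu 2%:E ->
  (\int[mu]_x (f x ^+ 2))%:E = (\int[mu]_x ((f x) ^+ 2)%:E)%E.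
Proof.
move=> f2; rewrite fineK//.
by apply: integrable_fin_num => //; exact: Lfun2_integrable_sqr.
Qed.

Lemma Rintegral_sqr_eq0 f : f \in Lfun mu 2%:E ->
  \int[mu]_x (f x ^+ 2) = 0 -> {ae mu, forall x, f x = 0}.
Proof.
move=> f2 f0; have mf := Lfun2_measurable f2.
have m2 : measurable_fun setT (fun x => ((f x) ^+ 2)%:E).
  by apply/measurable_EFinP; exact: measurable_funX.
have [h _] := ae_eq_integral_abs mu measurableT m2.
have /h : (\int[mu]_x `|((f x) ^+ 2)%:E| = 0)%E.
  under eq_integral => x _ do rewrite abse_EFin ger0_norm ?sqr_ge0//.
  by rewrite -Rintegral_sqr_fin// f0.
by apply: filterS => x /(_ I) [] /eqP; rewrite sqrf_eq0 => /eqP.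
Qed.

End SquareIntegrable.

Section Completeness.
Context d {T : measurableType d} {R : realType} {mu : {measure set T -> \bar R}}.

Lemma sum_half_pow n : \sum_(0 <= k < n) (2^-1 : R) ^+ k = 2 - 2 * 2^-1 ^+ n.
Proof.
elim: n => [|n IH]; first by rewrite big_nil expr0; lra.
by rewrite big_nat_recr//= IH exprS; lra.
Qed.

Lemma is_cvg_of_sum_sqr (v : nat -> R) (M : R) :
  (forall n, \sum_(0 <= k < n) 2 ^+ k * (v k.+1 - v k) ^+ 2 <= M) -> cvgn v.
Proof.
move=> vM.
(* By the arithmetic-geometric inequality the increments are dominated by
   2^k (v_(k+1) - v_k)^2 + 2^-k, whose sums are bounded. *)
have tele : cvgn (series (telescope v)).
  apply: normed_cvg; apply: nondecreasing_is_cvgn.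
    by apply: nondecreasing_series => k _ _; exact: normr_ge0.
  exists (M + 2) => _ [n _ <-] /=.
  apply: (@le_trans _ _ (\sum_(0 <= k < n) (2 ^+ k * (v k.+1 - v k) ^+ 2 + 2^-1 ^+ k))).
    rewrite /series/=; apply: ler_sum => k _; rewrite /telescope.
    have k0 : 0 < 2 ^+ k :> R by rewrite exprn_gt0.
    rewrite exprVn -[(_ - _) ^+ 2]real_normK ?num_real//.
    set a := `|_|; have a0 : 0 <= a by exact: normr_ge0.
    have -> : 2 ^+ k * a ^+ 2 + (2 ^+ k)^-1 =
        2 ^+ k * (a - (2 ^+ k)^-1) ^+ 2 + 2 * a.
      by field; rewrite gt_eqF.
    rewrite -subr_ge0 -addrA; apply: addr_ge0; last lra.
    by rewrite mulr_ge0 ?sqr_ge0// ltW.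
  rewrite big_split/= sum_half_pow lerD//.
  by rewrite lerBlDr lerDl mulr_ge0 ?exprn_ge0 ?invr_ge0.
rewrite (_ : v = (fun n => v 0%N + series (telescope v) n)); last first.
  by apply/funext => n; rewrite -eq_sum_telescope.
by apply: is_cvgD; [exact: is_cvg_cst|exact: tele].
Qed.

(** Increments of squared norm 4^-k, weighted by 2^k, have a summable total
    integral, so that their weighted sum of squares is finite almost
    everywhere and [is_cvg_of_sum_sqr] applies. *)
Lemma fast_cvg_ae (v : nat -> T -> R) : (forall n, v n \in Lfun mu 2%:E) ->
  (forall k, \int[mu]_x ((v k.+1 x - v k x) ^+ 2) <= 2^-1 ^+ k * 2^-1 ^+ k) ->
  {ae mu, forall x, cvgn (v ^~ x)}.
Proof.
move=> v2 dv.
pose h k x : \bar R := (2 ^+ k * (v k.+1 x - v k x) ^+ 2)%:E.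
have h0 k x : (0 <= h k x)%E by rewrite /h lee_fin mulr_ge0 ?sqr_ge0 ?exprn_ge0.
have mh k : measurable_fun setT (h k).
  apply/measurable_EFinP; apply: measurable_funM => //.
  by apply: measurable_funX; apply: measurable_funB; exact: Lfun2_measurable (v2 _).
have mS : measurable_fun setT (fun x => \sum_(0 <= k <oo) h k x)%E.
  by apply: ge0_emeasurable_sum => //.
have iS : mu.-integrable setT (fun x => \sum_(0 <= k <oo) h k x)%E.
  apply/integrableP; split => //.
  under eq_integral => x _ do rewrite gee0_abs ?nneseries_ge0//.
  rewrite integral_nneseries//; apply: (@le_lt_trans _ _ 2%:E); last exact: ltry.
  apply: lime_le; first by apply: is_cvg_nneseries => k _ _; exact: integral_ge0.
  apply: nearW => n.
  apply: (@le_trans _ _ (\sum_(0 <= k < n) (2^-1 ^+ k)%:E)%E).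
    apply: lee_sum => k _; rewrite /h.
    under eq_integral do rewrite EFinM.
    have d2 := Lfun2B (v2 k.+1) (v2 k).
    rewrite ge0_integralZl//; last 2 first.
    - by apply/measurable_EFinP; apply: measurable_funX; exact: Lfun2_measurable d2.
    - by move=> x _; rewrite lee_fin sqr_ge0.
    rewrite -Rintegral_sqr_fin// -EFinM lee_fin.
    have k0 : 0 < 2 ^+ k :> R by rewrite exprn_gt0.
    apply: le_trans (ler_wpM2l (ltW k0) (dv k)) _.
    by rewrite mulrA exprVn divff ?mul1r// gt_eqF.
  by rewrite sumEFin lee_fin sum_half_pow lerBlDr lerDl mulr_ge0 ?exprn_ge0 ?invr_ge0.
apply: filterS (integrable_ae measurableT iS) => x /(_ I) fS.
apply: (@is_cvg_of_sum_sqr _ (fine (\sum_(0 <= k <oo) h k x)%E)) => n.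
rewrite -lee_fin fineK// -sumEFin.
exact: (@nneseries_lim_ge _ (h ^~ x) xpredT 0%N).
Qed.

Lemma limn_einf_le (u : (\bar R)^nat) (N : nat) (c : \bar R) :
  (forall n, (N <= n)%N -> u n <= c)%E -> (limn_einf u <= c)%E.
Proof.
move=> uc; rewrite limn_einf_lim; apply: lime_le; first exact: is_cvg_einfs.
exists N => // n /= Nn; apply: le_trans (uc _ Nn).
by apply: ereal_inf_lbound; exists n => /=.
Qed.

(** Riesz-Fischer.  The limit function is defined everywhere, by the same
    formula at each point, from the values of the sequence at that point: this
    is what the second clause records, and it transfers to the limit any
    pointwise symmetry of the sequence, such as periodicity. *)
Lemma Lfun2_complete (u : nat -> T -> R) :
  (forall n, u n \in Lfun mu 2%:E) ->
  (forall eps, 0 < eps -> exists N, forall m n, (N <= m)%N -> (N <= n)%N ->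
    \int[mu]_x ((u m x - u n x) ^+ 2) <= eps) ->
  exists f, [/\ f \in Lfun mu 2%:E,
    forall x y, (forall n, u n x = u n y) -> f x = f y &
    forall eps, 0 < eps -> exists N, forall n, (N <= n)%N ->
      \int[mu]_x ((u n x - f x) ^+ 2) <= eps].
Proof.
move=> u2 uC.
have /choice[N NP] k : exists N, forall m n, (N <= m)%N -> (N <= n)%N ->
    \int[mu]_x ((u m x - u n x) ^+ 2) <= 2^-1 ^+ k * 2^-1 ^+ k.
  by apply: uC; rewrite mulr_gt0 ?exprn_gt0 ?invr_gt0.
pose s k := (\sum_(j < k.+1) (N j).+1)%N.
have Ns k : (N k <= s k)%N by rewrite /s big_ord_recr/= addnS leqW// leq_addl.
have sS k : (s k <= s k.+1)%N by rewrite [in leqRHS]/s big_ord_recr leq_addr.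
have sk k : (k <= s k)%N.
  elim: k => // k IH; rewrite /s big_ord_recr/= addnS ltnS.
  by apply: leq_trans IH _; exact: leq_addr.
pose v k := u (s k).
have v2 k : v k \in Lfun mu 2%:E by exact: u2.
have vae : {ae mu, forall x, cvgn (v ^~ x)}.
  by apply: fast_cvg_ae => // k; apply: NP => //; exact: leq_trans (Ns k) (sS k).
pose f x := fine (limn_esup (fun k => (v k x)%:E)).
have mv k := Lfun2_measurable (v2 k).
have mf : measurable_fun setT f.
  apply: measurableT_comp; first exact: fine_measurable.
  by apply: measurable_fun_limn_esup => k; exact/measurable_EFinP.
have vf x : cvgn (v ^~ x) -> v ^~ x @ \oo --> f x.
  move=> cv; rewrite /f.
  have /cvg_limn_einf_sup[_ ->] : (fun k => (v k x)%:E) @ \oo --> (limn (v ^~ x))%:E.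
    by apply/fine_cvgP; split; [exact: nearW|exact: cv].
  exact: cv.
have close eps M : 0 < eps -> (forall m n, (M <= m)%N -> (M <= n)%N ->
    \int[mu]_x ((u m x - u n x) ^+ 2) <= eps) ->
    forall n, (M <= n)%N -> (\int[mu]_x ((u n x - f x) ^+ 2)%:E <= eps%:E)%E.
  move=> e0 MP n Mn.
  have mg k : measurable_fun setT (fun x => ((u n x - v k x) ^+ 2)%:E).
    apply/measurable_EFinP; apply: measurable_funX; apply: measurable_funB => //.
    exact: Lfun2_measurable (u2 n).
  have -> : (\int[mu]_x ((u n x - f x) ^+ 2)%:E =
      \int[mu]_x limn_einf (fun k => ((u n x - v k x) ^+ 2)%:E))%E.
    apply: ae_eq_integral => //.
    - apply/measurable_EFinP; apply: measurable_funX; apply: measurable_funB => //.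
      exact: Lfun2_measurable (u2 n).
    - rewrite (_ : (fun _ => _) =
          (fun x => - limn_esup (fun k => - ((u n x - v k x) ^+ 2)%:E))%E).
        apply: measurableT_comp => //; apply: measurable_fun_limn_esup => k.
        exact: measurableT_comp.
      apply/funext => x; rewrite -limn_einfN; congr limn_einf.
      by apply/funext => k /=; rewrite opprK.
    apply: filterS vae => x /vf vx _; apply/esym.
    apply: (cvg_limn_einf_sup _).1.
    apply/fine_cvgP; split; first exact: nearW.
    apply: (@cvg_comp _ _ _ (fun k => u n x - v k x) (fun t => t ^+ 2) _ (nbhs (u n x - f x))).
      by apply: cvgB => //; exact: cvg_cst.
    exact: exprn_continuous.
  (* Fatou along the almost everywhere convergent subsequence v. *)
  apply: le_trans (fatou _ _ _ _) _ => //.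
    by move=> k x _; rewrite lee_fin sqr_ge0.
  apply: (@limn_einf_le _ M) => k Mk.
  rewrite -Rintegral_sqr_fin; last exact: Lfun2B.
  by rewrite lee_fin MP// (leq_trans Mk).
have uf n : (fun x => u n x - f x) \in Lfun mu 2%:E -> f \in Lfun mu 2%:E.
  move=> /(Lfun2B (u2 n)); rewrite (_ : (fun _ => _ - _) = f)//.
  by apply/funext => x; rewrite opprB addrC subrK.
have f2 : f \in Lfun mu 2%:E.
  have [M MP] := uC 1 ltr01; apply: (uf M); apply/Lfun2P; split.
    by apply: measurable_funB => //; exact: Lfun2_measurable (u2 M).
  by apply: le_lt_trans (close _ _ ltr01 MP M (leqnn M)) _; exact: ltry.
exists f; split => //.
  by move=> x y uxy; rewrite /f; congr (fine (limn_esup _)); apply/funext => k; rewrite /v uxy.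
move=> eps e0; have [M MP] := uC _ e0; exists M => n Mn.
rewrite -lee_fin Rintegral_sqr_fin; last exact: Lfun2B.
exact: (close eps M).
Qed.

End Completeness.

(** * Restriction of a measure *)

Section Restriction.
Context d {T : measurableType d} {R : realType}.
Variables (nu : {measure set T -> \bar R}) (D : set T) (mD : measurable D).

Lemma ae_mrestr (P : T -> Prop) :
  {ae nu, forall x, D x -> P x} -> {ae mrestr nu mD, forall x, P x}.
Proof.
move=> [N [mN N0 PN]]; exists (N `|` ~` D); split.
- by apply: measurableU => //; exact: measurableC.
- apply/eqP; rewrite eq_le measure_ge0 andbT /= /mrestr setIUl setICl setU0 -N0.
  by apply: le_measure => //; rewrite inE//; exact: measurableI.
- move=> x /= Px; have [Dx|Dx] := pselect (D x); [left|by right].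
  by apply: PN => /= /(_ Dx).
Qed.

Lemma integral_mrestr (f : T -> \bar R) : measurable_fun setT f ->
  (\int[mrestr nu mD]_x f x = \int[nu]_(x in D) f x)%E.
Proof.
move=> mf; transitivity (\int[mrestr nu mD]_(x in D) f x)%E.
  rewrite [RHS]integral_mkcond; apply: ae_eq_integral => //.
    by apply: (measurable_restrictT _ mD).1; exact: measurable_funTS.
  apply: ae_mrestr; apply: aeW => x Dx _.
  by rewrite patchE mem_set.
apply: eq_measure_integral => A mA AD.
by rewrite /= /mrestr setIidl.
Qed.

Lemma integral_mrestrI (A : set T) (f : T -> \bar R) : measurable A ->
  measurable_fun setT f ->
  (\int[mrestr nu mD]_(x in A) f x = \int[nu]_(x in A `&` D) f x)%E.
Proof.
move=> mA mf; rewrite [LHS]integral_mkcond integral_mrestr.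
  by rewrite setIC integral_mkcondr.
by apply: (measurable_restrictT _ mA).1; exact: measurable_funTS.
Qed.

Lemma integrable_mrestr (f : T -> \bar R) : measurable_fun setT f ->
  (mrestr nu mD).-integrable setT f <-> nu.-integrable D f.
Proof.
move=> mf; split=> /integrableP[_ h]; apply/integrableP; split => //.
- exact: measurable_funTS.
- by rewrite -integral_mrestr//; exact: measurableT_comp.
- by rewrite integral_mrestr//; exact: measurableT_comp.
Qed.

End Restriction.

(** * Functions on the circle without Fourier coefficients *)

(** Hartley's function.  Its integer dilates form a real orthogonal basis
    indexed by Z alone, whose derivative stays within the family:
    (cas (n x))' = n cas (- n x). *)
Definition cas {R : realType} (x : R) : R := cos x + sin x.

Section Cas.
Context {R : realType}.
Implicit Types a b : R.

Lemma cas0 : cas (0 : R) = 1.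
Proof. by rewrite /cas cos0 sin0 addr0. Qed.

Lemma cas_bound a : `|cas a| <= 2.
Proof.
by apply: le_trans (ler_normD _ _) _; have := cos_max a; have := sin_max a; lra.
Qed.

Lemma cosM_cas a b : cos a * cas b = 2^-1 * (cas (b + a) + cas (b - a)).
Proof. rewrite /cas !cosD !sinD cosN sinN; by field. Qed.

Lemma sinM_cas a b : sin a * cas b = 2^-1 * (cas (- b + a) - cas (- b - a)).
Proof. rewrite /cas !cosD !sinD !cosN !sinN; by field. Qed.

Lemma casM_cas a b : cas a * cas b =
  2^-1 * (cas (a - b) + cas (b - a) + cas (a + b) - cas (- a - b)).
Proof. rewrite /cas !cosD !sinD !cosN !sinN; by field. Qed.

Lemma continuous_cas : continuous (@cas R).
Proof.
by move=> x; apply: cvgD; [exact: continuous_cos|exact: continuous_sin].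
Qed.

Lemma measurable_cas : measurable_fun setT (@cas R).
Proof. exact: continuous_measurable_fun continuous_cas. Qed.

End Cas.

Lemma bounded_setT (T : Type) (R : realType) (h : T -> R) (M : R) :
  (forall x, `|h x| <= M) -> [bounded h x | x in setT].
Proof.
by move=> hM; exists M; split=> [|y My x _]; [exact: num_real|exact: le_trans (hM x) (ltW My)].
Qed.

Section Circle.
Context {R : realType}.

Definition period : set (measurableTypeR R) := `[0, 2 * pi[.

Lemma measurable_period : measurable period.
Proof. exact: measurable_itv. Qed.

Lemma lebesgue_period_fin : (@lebesgue_measure R period < +oo)%E.
Proof. by rewrite lebesgue_measure_itv/=; case: ifP => // _; rewrite -EFinB ltry. Qed.

Definition period_measure :
    {finite_measure set (measurableTypeR R) -> \bar R} :=
  mfrestr measurable_period lebesgue_period_fin.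

Local Notation lam := period_measure.

(** The indicator function of an arc is a bounded limit of trigonometric
    polynomials, so a function [g] without Fourier coefficients has integral
    zero on arcs.  The trigonometric polynomials used are (1 - u^n)^(2^n), where
    the affine function u of cos (x - b / 2) takes values in [0, 1] and is
    smaller than 1/2 on the arc ]0, b[ and larger than 1/2 beyond b. *)
Section Uniqueness.
Variable g : R -> R.
Implicit Types p r : R -> R.
Hypothesis ig : lam.-integrable setT (EFin \o g).

(* The multipliers p such that g p still has no Fourier coefficient.  They are
   stable under multiplication by cos and sin, which avoids describing the
   algebra of trigonometric polynomials. *)
Let moment_free (p : R -> R) := [/\ measurable_fun setT p,
  exists M : R, forall x, `|p x| <= M &
  forall k : int, \int[lam]_x (g x * p x * cas (k%:~R * x)) = 0].

Let mulg_integrable p : measurable_fun setT p -> (exists M : R, forall x, `|p x| <= M) ->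
  lam.-integrable setT (EFin \o (fun x => g x * p x)).
Proof.
move=> mp [M pM]; have := integrableMl measurableT ig mp (bounded_setT pM).
by apply: eq_integrable => // x _ /=; rewrite EFinM.
Qed.

Let mcask (k : int) : measurable_fun setT (fun x : R => cas (k%:~R * x)).
Proof.
by apply: measurableT_comp; [exact: measurable_cas|exact: measurable_funM].
Qed.

Let moment_free_integrable p (k : int) : moment_free p ->
  lam.-integrable setT (EFin \o (fun x => g x * p x * cas (k%:~R * x))).
Proof.
move=> [mp [M pM] _].
have bd : exists M', forall x, `|p x * cas (k%:~R * x)| <= M'.
  by exists (M * 2) => x; rewrite normrM ler_pM ?cas_bound.
have := mulg_integrable (measurable_funM mp (mcask k)) bd.
by apply: eq_integrable => // x _ /=; rewrite mulrA.
Qed.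

Let moment_free_lin a b p r : moment_free p -> moment_free r ->
  moment_free (fun x => a * p x + b * r x).
Proof.
move=> Ap Ar; have [mp [M pM] p0] := Ap; have [mr [N rN] r0] := Ar.
split.
- by apply: measurable_funD; exact: measurable_funM.
- exists (`|a| * M + `|b| * N) => x; apply: le_trans (ler_normD _ _) _.
  by rewrite !normrM lerD// ler_wpM2l.
- move=> k; rewrite (@eq_Rintegral _ _ _ lam _ (fun x => a * (g x * p x * cas (k%:~R * x)) +
      b * (g x * r x * cas (k%:~R * x)))); last by move=> x _; ring.
  rewrite RintegralD//=; [|exact: (integrableZl measurableT _ (moment_free_integrable k Ap))|
    exact: (integrableZl measurableT _ (moment_free_integrable k Ar))].
  by rewrite !RintegralZl ?p0 ?r0 ?mulr0 ?addr0//; exact: moment_free_integrable.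
Qed.

Let moment_free_cos p : moment_free p -> moment_free (fun x => p x * cos x).
Proof.
move=> Ap; have [mp [M pM] p0] := Ap; split.
- by apply: measurable_funM => //; apply: continuous_measurable_fun; exact: continuous_cos.
- exists (M * 1) => x; rewrite normrM ler_pM// cos_max//.
- move=> k; rewrite (@eq_Rintegral _ _ _ lam _ (fun x =>
      2^-1 * (g x * p x * cas ((k + 1)%:~R * x)) +
      2^-1 * (g x * p x * cas ((k - 1)%:~R * x)))); last first.
    move=> x _; rewrite -!mulrA cosM_cas rmorphD rmorphB /= !mulrDl mulN1r mul1r; ring.
  rewrite RintegralD//=; [|exact: (integrableZl measurableT _ (moment_free_integrable _ Ap))|
    exact: (integrableZl measurableT _ (moment_free_integrable _ Ap))].
  by rewrite !RintegralZl ?p0 ?mulr0 ?addr0//; exact: moment_free_integrable.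
Qed.

Let moment_free_sin p : moment_free p -> moment_free (fun x => p x * sin x).
Proof.
move=> Ap; have [mp [M pM] p0] := Ap; split.
- by apply: measurable_funM => //; apply: continuous_measurable_fun; exact: continuous_sin.
- exists (M * 1) => x; rewrite normrM ler_pM// sin_max//.
- move=> k; rewrite (@eq_Rintegral _ _ _ lam _ (fun x =>
      2^-1 * (g x * p x * cas ((- k + 1)%:~R * x)) +
      - 2^-1 * (g x * p x * cas ((- k - 1)%:~R * x)))); last first.
    move=> x _; rewrite -!mulrA sinM_cas rmorphD rmorphB rmorphN /= !mulrDl.
    rewrite mulN1r mul1r mulNr; ring.
  rewrite RintegralD//=; [|exact: (integrableZl measurableT _ (moment_free_integrable _ Ap))|
    exact: (integrableZl measurableT _ (moment_free_integrable _ Ap))].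
  by rewrite !RintegralZl ?p0 ?mulr0 ?addr0//; exact: moment_free_integrable.
Qed.

Hypothesis g0 : forall k : int, \int[lam]_x (g x * cas (k%:~R * x)) = 0.

Let moment_free1 : moment_free (cst 1).
Proof.
split => //; first by exists 1 => x; rewrite normr1.
by move=> k; under eq_Rintegral do rewrite mulr1; exact: g0.
Qed.

Variable b : R.
Hypothesis b_itv : 0 < b < 2 * pi.

Let u x : R := 2^-1 + (cos (b / 2) - cos (x - b / 2)) / 4.

Let u_itv x : 0 <= u x <= 1.
Proof.
rewrite /u; have := cos_le1 (b / 2); have := cos_geN1 (b / 2).
have := cos_le1 (x - b / 2); have := cos_geN1 (x - b / 2); lra.
Qed.

Let moment_free_u p : moment_free p -> moment_free (fun x => p x * u x).
Proof.
move=> Ap; have Ac := moment_free_cos Ap; have As := moment_free_sin Ap.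
have := moment_free_lin 1 (- 4^-1) (moment_free_lin (2^-1 + cos (b / 2) / 4) 0 Ap Ap)
  (moment_free_lin (cos (b / 2)) (sin (b / 2)) Ac As).
by congr moment_free; apply/funext => x; rewrite /u cosB; by field.
Qed.

Let moment_free_un p n : moment_free p -> moment_free (fun x => p x * u x ^+ n).
Proof.
elim: n p => [|n IH] p Ap.
  by have := Ap; congr moment_free; apply/funext => x; rewrite mulr1.
have := IH _ (moment_free_u Ap); congr moment_free; apply/funext => x; rewrite exprS; ring.
Qed.

Let q n x := (1 - u x ^+ n) ^+ (2 ^ n).

Let moment_free_q n : moment_free (q n).
Proof.
rewrite /q; elim: (2 ^ n)%N => [|m IH]; first exact: moment_free1.
have := moment_free_lin 1 (-1) IH (moment_free_un n IH); congr moment_free.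
by apply/funext => x; rewrite exprS; ring.
Qed.

Let q_itv n x : 0 <= q n x <= 1.
Proof.
have /andP[u0 u1] := u_itv x.
have un : 0 <= u x ^+ n <= 1 by rewrite exprn_ge0//= exprn_ile1.
rewrite /q exprn_ge0 ?exprn_ile1//; lra.
Qed.

Let cos_in x : 0 < x < b -> cos (b / 2) < cos (x - b / 2).
Proof.
move=> /andP[x0 xb]; case/andP: b_itv => b0 b2.
rewrite -[cos (x - _)]cos_norm ltr_cos ?in_itv/=.
- by rewrite ltr_norml; lra.
- by rewrite normr_ge0/= ler_norml; lra.
- lra.
Qed.

Let cos_out x : b < x < 2 * pi -> cos (x - b / 2) < cos (b / 2).
Proof.
move=> /andP[bx x2]; case/andP: b_itv => b0 b2.
have [xpi|xpi] := leP (x - b / 2) pi.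
  rewrite ltr_cos ?in_itv/=; lra.
rewrite -[cos (x - _)]cosN -(cosD2pi (- (x - b / 2))) ltr_cos ?in_itv/=; lra.
Qed.

Let q_cvg_in x : 0 < x < b -> q ^~ x @ \oo --> (1 : R).
Proof.
move=> xb; have /andP[u0 u1] := u_itv x.
have uh : u x < 2^-1 by rewrite /u; have := cos_in xb; lra.
have lower n : 1 - (2 * u x) ^+ n <= q n x.
  have -> : 1 - (2 * u x) ^+ n = 1 - (2 ^ n)%:R * u x ^+ n by rewrite exprMn natrX.
  have un : 0 <= u x ^+ n <= 1 by rewrite exprn_ge0//= exprn_ile1.
  (* Bernoulli: (1 - v)^m >= 1 - m v. *)
  rewrite /q; elim: (2 ^ n)%N => [|m IH]; first by rewrite mul0r subr0.
  rewrite exprS -natr1.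
  have : 0 <= (1 - u x ^+ n) ^+ m <= 1 by rewrite exprn_ge0 ?exprn_ile1//; lra.
  move: IH; set w := _ ^+ m; set v := u x ^+ n in un *; nra.
apply: (@squeeze_cvgr _ _ _ _ (fun n => 1 - (2 * u x) ^+ n) (cst 1)).
- by apply: nearW => n; rewrite lower; have /andP[] := q_itv n x.
- rewrite -[X in _ --> X]subr0; apply: cvgB; first exact: cvg_cst.
  have : `|2 * u x| < 1 by rewrite ger0_norm; lra.
  move/(cvg_geometric 1); rewrite /geometric/=.
  by under eq_fun do rewrite mul1r.
- exact: cvg_cst.
Qed.

Let q_cvg_out x : b < x < 2 * pi -> q ^~ x @ \oo --> (0 : R).
Proof.
move=> bx; have /andP[u0 u1] := u_itv x.
have uh : 2^-1 < u x by rewrite /u; have := cos_out bx; lra.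
have upper n : q n x <= ((2 * u x)^-1) ^+ n.
  rewrite exprVn -[leRHS]mul1r ler_pdivlMr ?exprn_gt0//; last lra.
  have -> : (2 * u x) ^+ n = (2 ^ n)%:R * u x ^+ n by rewrite exprMn natrX.
  have un : 0 <= u x ^+ n <= 1 by rewrite exprn_ge0//= exprn_ile1.
  (* (1 - v)^m (1 + m v) <= 1, by induction on m. *)
  suff : q n x * (1 + (2 ^ n)%:R * u x ^+ n) <= 1.
    by have /andP[] := q_itv n x; nra.
  rewrite /q; elim: (2 ^ n)%N => [|m IH]; first by rewrite mul0r addr0 mulr1.
  rewrite exprS -natr1.
  have : 0 <= (1 - u x ^+ n) ^+ m by rewrite exprn_ge0//; lra.
  have : 0 <= m%:R :> R by [].
  move: IH; set w := _ ^+ m; set v := u x ^+ n in un *; set r := m%:R => h r0 w0.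
  apply: le_trans h.
  have -> : (1 - v) * w * (1 + (r + 1) * v) =
    w * (1 + r * v) - w * ((r + 1) * v ^+ 2) by ring.
  by rewrite gerBl !mulr_ge0 ?addr_ge0//; case/andP: un.
apply: (@squeeze_cvgr _ _ _ _ (cst 0) (fun n => ((2 * u x)^-1) ^+ n)).
- by apply: nearW => n; rewrite upper andbT; have /andP[] := q_itv n x.
- exact: cvg_cst.
- have : `|(2 * u x)^-1| < 1.
    by rewrite ger0_norm ?invr_ge0 ?invf_lt1; lra.
  move/(cvg_geometric 1); rewrite /geometric/=.
  by under eq_fun do rewrite mul1r.
Qed.

Lemma integral_initial_arc : \int[lam]_(x in `]-oo, b]) g x = 0.
Proof.
case/andP: b_itv => b0 b2.
have mg : measurable_fun setT g by case/integrableP: ig => /measurable_EFinP.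
have mb : measurable (`]-oo, b] : set (measurableTypeR R)) by exact: measurable_itv.
have ae_q : {ae lam, forall x, q ^~ x @ \oo --> (\1_`]-oo, b] x : R)}.
  apply: ae_mrestr.
  have ae_ne c : {ae @lebesgue_measure R, forall x, x <> c}.
    exists [set c]; split => //; first exact: lebesgue_measure_set1.
    by move=> x /= /contrapT.
  apply: filterS2 (ae_ne 0) (ae_ne b) => x /eqP x0 /eqP xb.
  rewrite /period/= in_itv/= => /andP[x0' x2].
  have {x0 x0'} x0 : 0 < x by rewrite lt_neqAle eq_sym x0.
  move: xb; rewrite neq_lt => /orP[xb|xb].
    have -> : \1_`]-oo, b] x = 1 :> R by rewrite indicE mem_set//= in_itv/= ltW.
    by apply: q_cvg_in; rewrite x0.
  have -> : \1_`]-oo, b] x = 0 :> R by rewrite indicE memNset//= in_itv/= leNgt xb.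
  by apply: q_cvg_out; rewrite xb.
have mq n : measurable_fun setT (fun x => (g x * q n x)%:E).
  by apply/measurable_EFinP; apply: measurable_funM => //; case: (moment_free_q n).
have m1 : measurable_fun setT (fun x => (g x * \1_`]-oo, b] x)%:E).
  by apply/measurable_EFinP; apply: measurable_funM => //; exact: measurable_indic.
have q_lim : {ae lam, forall x, setT x ->
    (g x * q n x)%:E @[n --> \oo] --> (g x * \1_`]-oo, b] x)%:E}.
  apply: (@filterS _ _ (ae_filter_ringOfSetsType lam) _ _ _ ae_q) => x qx _.
  apply/fine_cvgP; split; first exact: nearW.
  by apply: cvgM => //; exact: cvg_cst.
have q_dom : {ae lam, forall x n, setT x -> (`|(g x * q n x)%:E| <= `|(EFin \o g) x|)%E}.
  apply: aeW => x n _; rewrite lee_fin normrM ler_piMr//.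
  by rewrite ger0_norm; have /andP[] := q_itv n x.
have [_ _ lim] := @dominated_convergence _ (measurableTypeR R) R lam setT measurableT
  _ _ _ mq m1 q_lim (integrable_abse ig) q_dom.
have qn0 n : (\int[lam]_x (g x * q n x)%:E = 0)%E.
  have [_ _ /(_ 0)] := moment_free_q n; have := moment_free_integrable 0 (moment_free_q n).
  have -> : (fun x => g x * q n x * cas (0%:~R * x)) = (fun x => g x * q n x).
    by apply/funext => x; rewrite mul0r cas0 mulr1.
  by move=> igq e; rewrite -[LHS]fineK ?[fine _]e//; exact: integrable_fin_num igq.
have : (\int[lam]_x (g x * \1_`]-oo, b] x)%:E = 0)%E.
  move: lim; rewrite (_ : (fun n => _) = cst 0%E); last by apply/funext => n; exact: qn0.
  by move=> lim; apply: cvg_unique lim _; [exact: ereal_hausdorff|exact: cvg_cst].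
move=> e; rewrite Rintegral_mkcond /Rintegral.
rewrite -[RHS]/(fine 0%E) -e; congr fine; apply: eq_integral => x _.
congr (_ %:E); rewrite patchE indicE; case: ifP => _; rewrite ?mulr1 ?mulr0//.
Qed.

End Uniqueness.

(** By [integral_initial_arc] the primitive of [g] starting at 0 vanishes on the
    period, hence so does [g], by Lebesgue's differentiation theorem. *)
Theorem circle_uniqueness (g : R -> R) : lam.-integrable setT (EFin \o g) ->
  (forall k : int, \int[lam]_x (g x * cas (k%:~R * x)) = 0) ->
  {ae lam, forall x, g x = 0}.
Proof.
move=> ig g0.
have mg : measurable_fun setT g by case/integrableP: ig => /measurable_EFinP.
have iL : (@lebesgue_measure R).-integrable period (EFin \o g).
  by apply/(@integrable_mrestr _ _ _ _ _ measurable_period) => //; exact/measurable_EFinP.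
pose f := g \_ period.
have if_ : (@lebesgue_measure R).-integrable setT (EFin \o f).
  by rewrite /f -restrict_EFin; exact: (integrable_mkcond _ measurable_period).1 iL.
have F0 x : \int[lebesgue_measure]_(t in `]-oo, x]) f t = 0.
  have mx : measurable (`]-oo, x] : set (measurableTypeR R)) by exact: measurable_itv.
  rewrite -Rintegral_mkcondr.
  have [x0|x0] := leP x 0.
    rewrite /Rintegral (@integral_Sset1 _ _ _ 0)// => t /=.
    rewrite /period/= !in_itv/= => -[tx /andP[t0 _]].
    by apply/eqP; rewrite eq_le t0 (le_trans tx).
  have [x2|x2] := leP (2 * pi) x.
    rewrite setIidr.
      have := g0 0; rewrite (_ : (fun _ => _ * _) = g).
        move=> <-; congr fine; apply/esym/integral_mrestr.
        exact/measurable_EFinP.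
      by apply/funext => t; rewrite mul0r cas0 mulr1.
    by move=> t; rewrite /period/= !in_itv/= => /andP[_ t2]; rewrite ltW// (lt_le_trans t2).
  rewrite -[RHS](integral_initial_arc ig g0 (b := x)) ?x0//.
  by rewrite /Rintegral integral_mrestrI//; exact/measurable_EFinP.
have : {ae @lebesgue_measure R, forall x, f x = 0}.
  have locf : locally_integrable setT f.
    exact: (integrable_locally_restrict measurable_period iL).
  have := @FTC1Ny _ f _ locf; move=> h.
  have ify y : (@lebesgue_measure R).-integrable
      (`]-oo, y] : set (measurableTypeR R)) (EFin \o f).
    by apply: (@integrableS _ (measurableTypeR R) _ _ setT) => //; exact: measurable_itv.
  apply: (@filterS _ _ (ae_filter_ringOfSetsType (@lebesgue_measure R)) _ _ _ (h ify)).
  move=> x [_ <-].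
  rewrite (_ : (fun _ => _) = cst 0); last by apply/funext.
  by rewrite derive1_cst.
move=> f0; apply: ae_mrestr; apply: filterS f0 => x + px.
by rewrite /f patchE mem_set.
Qed.

End Circle.

(** * Functions on the torus without Fourier coefficients *)

Section TorusUniqueness.
Context {R : realType}.
Local Notation lam := (@period_measure R).
Local Notation mu := (@torus_measure R).

(** The torus is the product of two circles, also as a measure space; this is
    what makes Fubini's theorem available. *)
Lemma torus_measureE A : measurable A -> (lam \x lam)%E A = mu A.
Proof.
apply: product_measure_unique => X Y mX mY.
rewrite /= /mrestr /mfrestr /mrestr.
have -> : X `*` Y `&` cell = (X `&` period) `*` (Y `&` period).
  by apply/seteqP; split => -[x y] /=; rewrite /cell /period/=; tauto.
by apply: product_measure1E; apply: measurableI => //; exact: measurable_period.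
Qed.

Lemma torus_integralE (f : R * R -> \bar R) :
  (\int[mu]_x f x = \int[(lam \x lam)%E]_x f x)%E.
Proof. by apply: eq_measure_integral => A mA _; rewrite -torus_measureE. Qed.

Lemma torus_integrableE (f : R * R -> \bar R) : mu.-integrable setT f <->
  (lam \x lam)%E.-integrable setT f.
Proof.
split=> /integrableP[mf h]; apply/integrableP; (split; first exact: mf).
  by rewrite -torus_integralE.
by rewrite torus_integralE.
Qed.

Lemma ae_torus (P : R * R -> Prop) :
  {ae (lam \x lam)%E, forall x, P x} -> {ae mu, forall x, P x}.
Proof.
move=> [N [mN N0 PN]]; exists N; split; [exact: mN| |exact: PN].
by rewrite -N0 -torus_measureE.
Qed.

Lemma period_mass : lam setT = (2 * pi)%:E.
Proof.
rewrite /= /mfrestr /mrestr setTI lebesgue_measure_itv/= lte_fin.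
by rewrite mulr_gt0 ?pi_gt0// -EFinB subr0.
Qed.

Lemma torus_mass : mu setT = ((2 * pi) ^+ 2)%:E.
Proof.
rewrite -torus_measureE; last exact: measurableT.
rewrite -setXTT product_measure1E; [|exact: measurableT|exact: measurableT].
have : (lam setT * lam setT = ((2 * pi) ^+ 2)%:E)%E by rewrite period_mass -EFinM expr2.
exact.
Qed.

Lemma torus_finite : (mu setT < +oo)%E.
Proof. by rewrite torus_mass ltry. Qed.

Local Notation P := (lam \x lam)%E.
Local Notation R2 := (measurableTypeR R * measurableTypeR R)%type.

Let measurable_cas_fst (k : int) :
  measurable_fun setT (fun z : R2 => cas (k%:~R * z.1) : R).
Proof.
by apply: measurableT_comp; [exact: measurable_cas|exact: measurable_funM].
Qed.

Let measurable_cas_snd (k : int) :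
  measurable_fun setT (fun z : R2 => cas (k%:~R * z.2) : R).
Proof.
by apply: measurableT_comp; [exact: measurable_cas|exact: measurable_funM].
Qed.

(** Two applications of [circle_uniqueness].  For fixed k the partial coefficient
    F k x, the integral of f(x, y) cas(k y) in y, has no Fourier coefficient in
    x, so it vanishes for almost every x; there are countably many k, so for
    almost every x the section f(x, .) has no Fourier coefficient. *)
Theorem torus_uniqueness (f : R * R -> R) : mu.-integrable setT (EFin \o f) ->
  (forall j k : int, \int[mu]_x (f x * cas (j%:~R * x.1 + k%:~R * x.2)) = 0) ->
  {ae mu, forall x, f x = 0}.
Proof.
move=> ifmu f0; have /torus_integrableE if_ := ifmu.
have mf := measurable_int _ if_.
have f0' j k : \int[mu]_x (f x * (cas (j%:~R * x.1) * cas (k%:~R * x.2))) = 0.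
  have icas a b : mu.-integrable setT
      (EFin \o (fun x => f x * cas (a%:~R * x.1 + b%:~R * x.2))).
    have mcab : measurable_fun setT
        (fun x : measurableTypeR R * measurableTypeR R => cas (a%:~R * x.1 + b%:~R * x.2) : R).
      apply: measurableT_comp; first exact: measurable_cas.
      by apply: measurable_funD; exact: measurable_funM.
    have := integrableMl measurableT ifmu mcab (bounded_setT (fun z => cas_bound _)).
    by apply: eq_integrable => // x _ /=; rewrite EFinM.
  rewrite (_ : (fun _ => _) = (fun x => 2^-1 * (f x * cas (j%:~R * x.1 + (- k)%:~R * x.2)
     + f x * cas ((- j)%:~R * x.1 + k%:~R * x.2)
     + f x * cas (j%:~R * x.1 + k%:~R * x.2)
     - f x * cas ((- j)%:~R * x.1 + (- k)%:~R * x.2)))); last first.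
    apply/funext => x; rewrite casM_cas !rmorphN/= !mulNr.
    by rewrite [k%:~R * x.2 - _]addrC; ring.
  have i2 := integrableD measurableT (icas j (- k)) (icas (- j) k).
  have i3 := integrableD measurableT i2 (icas j k).
  have i4 := integrableB measurableT i3 (icas (- j) (- k)).
  rewrite RintegralZl// RintegralB// RintegralD// RintegralD// !f0; ring.
pose h k (z : measurableTypeR R * measurableTypeR R) := f z * cas (k%:~R * z.2).
have ih k : P.-integrable setT (EFin \o h k).
  have := integrableMl measurableT if_ (measurable_cas_snd k)
    (bounded_setT (fun z => cas_bound _)).
  by apply: eq_integrable => // x _ /=; rewrite EFinM.
pose F k := fubini_F lam (EFin \o h k).
have iF k : lam.-integrable setT (F k) by exact: integrable_fubini_F.
have F0 k : {ae lam, forall x, F k x = 0%E}.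
  pose g x := fine (F k x).
  have Ffin := integrable_ae measurableT (iF k).
  have mg : measurable_fun setT g.
    by apply: measurableT_comp; [exact: fine_measurable|exact: measurable_int (iF k)].
  have ig : lam.-integrable setT (EFin \o g).
    apply: (le_integrable measurableT _ _ (iF k)); first exact/measurable_EFinP.
    by move=> x _ /=; rewrite /g; case: (F k x) => [r| |] //=; rewrite ?normr0 ?leey.
  have g0 : {ae lam, forall x, g x = 0}.
    apply: circle_uniqueness ig _ => j.
    rewrite -(f0' j k) /Rintegral torus_integralE.
    pose w (z : measurableTypeR R * measurableTypeR R) := h k z * cas (j%:~R * z.1).
    have iw : P.-integrable setT (EFin \o w).
      have := integrableMl measurableT (ih k) (measurable_cas_fst j)
        (bounded_setT (fun z => cas_bound _)).
      by apply: eq_integrable => // x _ /=; rewrite EFinM.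
    congr fine; transitivity (\int[P]_z (EFin \o w) z)%E; last first.
      by apply: eq_integral => z _; rewrite /w /h /= -mulrA [cas _ * cas _]mulrC.
    rewrite -(integral12_prod_meas1 iw); apply: ae_eq_integral => //.
    - apply/measurable_EFinP; apply: measurable_funM => //.
      by apply: measurableT_comp; [exact: measurable_cas|exact: measurable_funM].
    - exact: measurable_int (integrable_fubini_F iw).
    apply: (@filterS2 _ _ (ae_filter_ringOfSetsType lam) _ _ _ _ Ffin (ae_integrable1 (ih k))).
    move=> x /(_ I) Fx ihx _.
    transitivity (F k x * (cas (j%:~R * x))%:E)%E; first by rewrite EFinM fineK.
    by rewrite /F /fubini_F -integralZr//; apply: eq_integral => y _; rewrite -EFinM.
  apply: (@filterS2 _ _ (ae_filter_ringOfSetsType lam) _ _ _ _ Ffin g0).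
  by move=> x /(_ I) Fx gx; rewrite -[LHS]fineK// -/(g x) gx.
have F0' : {ae lam, forall x, forall n, F (n%:Z) x = 0%E /\ F (- n%:Z) x = 0%E}.
  apply: ae_foralln => n.
  apply: (@filterS2 _ _ (ae_filter_ringOfSetsType lam) _ _ _ _ (F0 n) (F0 (- n%:Z))).
  by move=> x.
have sec0 : {ae lam, forall x, {ae lam, forall y, f (x, y) = 0}}.
  apply: (@filterS2 _ _ (ae_filter_ringOfSetsType lam) _ _ _ _ F0' (ae_integrable1 if_)).
  move=> x Fx ifx; apply: circle_uniqueness ifx _ => k.
  rewrite /Rintegral -[RHS]/(fine 0%E); congr fine.
  by have [n [->|->]] : exists n, k = n%:Z \/ k = - n%:Z;
    [case: k => n; [exists n; left|exists n.+1; right; rewrite NegzE]|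
     exact: (Fx n).1|exact: (Fx n).2].
apply: ae_torus.
have abs0 : (\int[P]_z `|(EFin \o f) z| = 0)%E.
  rewrite fubini_tonelli1//; last exact: measurableT_comp.
  rewrite -(integral0 lam setT); apply: ae_eq_integral => //.
    by apply: measurable_fun_fubini_tonelli_F => //; exact: measurableT_comp.
  apply: (@filterS _ _ (ae_filter_ringOfSetsType lam) _ _ _ sec0) => x fx _.
  rewrite /fubini_F -(integral0 lam setT); apply: ae_eq_integral => //.
    apply: measurableT_comp => //; exact: measurableT_comp.
  apply: (@filterS _ _ (ae_filter_ringOfSetsType lam) _ _ _ fx) => y /= -> _.
  by rewrite normr0.
have := (ae_eq_integral_abs _ measurableT mf).1 abs0.
by apply: (@filterS _ _ (ae_filter_ringOfSetsType P)) => z /(_ I) [].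
Qed.

End TorusUniqueness.

(** * The Hartley modes of the torus *)

Section Modes.
Context {R : realType}.
Local Notation lam := (@period_measure R).
Local Notation mu := (@torus_measure R).
Implicit Types k l : int * int.

Definition phase k (x : R * R) : R := k.1%:~R * x.1 + k.2%:~R * x.2.

Definition mode k (x : R * R) : R := cas (phase k x).

Definition freq (i : 'I_2) k : int := if i == 0 then k.1 else k.2.

Lemma phaseN k x : phase (- k) x = - phase k x.
Proof. by rewrite /phase /= !rmorphN/= !mulNr opprD. Qed.

Lemma phaseD k l x : phase (k + l) x = phase k x + phase l x.
Proof. by rewrite /phase /= !rmorphD/=; ring. Qed.

Lemma cas_periodz (a : R) (n : int) : cas (a + n%:~R * (2 * pi)) = cas a.
Proof.
have pos (m : nat) (b : R) : cas (b + m%:R * (2 * pi)) = cas b.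
  rewrite !mulr_natl /cas.
  by rewrite (periodicn (@cosD2pi R)) (periodicn (@sinD2pi R)).
case: n => n; first by rewrite -pmulrn pos.
by rewrite NegzE rmorphN/= mulNr -{2}(subrK (n.+1%:R * (2 * pi)) a) -pmulrn pos.
Qed.

Lemma mode_periodic k : torus_periodic (mode k).
Proof.
move=> x; rewrite /mode; split.
  by rewrite -[RHS](cas_periodz _ k.1) /phase/=; congr cas; ring.
by rewrite -[RHS](cas_periodz _ k.2) /phase/=; congr cas; ring.
Qed.

Lemma is_derive_cas_affine (n c x : R) :
  is_derive x 1 (fun t => cas (n * t + c)) (n * cas (- (n * x + c))).
Proof.
have -> : (fun t => cas (n * t + c)) = (fun t => cos (n * t + c) + sin (n * t + c)) by [].
apply: is_derive_eq.
by rewrite /cas cosN sinN (_ : n%:A = n); [ring|exact: mulr1].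
Qed.

(** The constant [c] makes the statement stable under iteration, which gives
    smoothness of the modes by induction in [test_mode]. *)
Lemma derive_mode c k i : (forall x, derivable (fun y => c * mode k y) x (dir i)) /\
  'D_(dir i) (fun y => c * mode k y) = (fun y => (c * (freq i k)%:~R) * mode (- k) y).
Proof.
have lim x : h^-1 *: (((fun y => c * mode k y) \o shift x) (h *: dir i) - c * mode k x)
    @[h --> 0^'] --> c * (freq i k)%:~R * mode (- k) x.
  set n : R := (freq i k)%:~R.
  have step (h : R) : phase k (h *: dir i + x) = n * h + phase k x.
    rewrite /n /phase /freq /dir; case: ifP => _ /=;
      rewrite ?scaler0 ?scale0r /GRing.scale/=; ring.
  have [cv dE] := is_derive_cas_affine n (phase k x) 0.
  have lim0 : h^-1 *: (cas (n * h + phase k x) - cas (phase k x)) @[h --> 0^'] -->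
      n * cas (- phase k x).
    have -> : n * cas (- phase k x) = n * cas (- (n * 0 + phase k x)) by rewrite mulr0 add0r.
    rewrite -dE; move: cv; rewrite /derivable /derive.
    rewrite (_ : (fun h => _) = (fun h => h^-1 *:
        (cas (n * h + phase k x) - cas (phase k x))))//.
    by apply/funext => h; rewrite /= mulr0 add0r addr0 /GRing.scale/= mulr1.
  rewrite (_ : (fun h => _) = (fun h => c * (h^-1 *:
      (cas (n * h + phase k x) - cas (phase k x))))); last first.
    by apply/funext => h; rewrite /= /mode step -mulrBr /GRing.scale/= mulrCA.
  rewrite -mulrA /mode phaseN; exact: cvgM (cvg_cst c) lim0.
split=> [x|]; first by apply/cvg_ex; exists (c * (freq i k)%:~R * mode (- k) x); exact: lim.
by apply/funext => x; apply/cvg_lim; [exact: Rhausdorff|exact: lim].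
Qed.

Lemma continuous_mode c k : continuous (fun x => c * mode k x).
Proof.
move=> x; apply: cvgM; first exact: cvg_cst.
apply: (@continuous_comp _ _ _ (phase k) cas); last exact: continuous_cas.
apply: cvgD; apply: cvgM; try exact: cvg_cst.
  exact: cvg_fst.
exact: cvg_snd.
Qed.

Lemma test_mode k : test_function (mode k).
Proof.
split; first exact: mode_periodic.
have cn n c l : Cn n (fun x => c * mode l x).
  elim: n c l => [|n IH] c l /=; first exact: continuous_mode.
  by move=> i; have [h1 ->] := derive_mode c l i.
move=> n; rewrite (_ : mode k = (fun x => 1 * mode k x)) //.
by apply/funext => x; rewrite mul1r.
Qed.

Lemma D_mode k i : 'D_(dir i) (mode k) = (fun y => (freq i k)%:~R * mode (- k) y).
Proof.
rewrite (_ : mode k = (fun x => 1 * mode k x)).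
  by have [_ ->] := derive_mode 1 k i; apply/funext => x; rewrite mul1r.
by apply/funext => x; rewrite mul1r.
Qed.

Lemma integral_period_cas (n : int) (c : R) : n != 0 ->
  (\int[lam]_x (cas (n%:~R * x + c))%:E = 0)%E.
Proof.
move=> n0; have nR : n%:~R != 0 :> R by rewrite intr_eq0.
have pi0 : 0 < 2 * pi :> R by rewrite mulr_gt0 ?pi_gt0.
have cc : continuous (fun x : R => cas (n%:~R * x + c)).
  move=> x; apply: differentiable_continuous; apply/derivable1_diffP.
  by have [] := is_derive_cas_affine n%:~R c x.
have mc : measurable_fun setT (fun x : R => cas (n%:~R * x + c)).
  exact: continuous_measurable_fun.
rewrite integral_mrestr; last exact/measurable_EFinP.
rewrite integral_itv_bndo_bndc; last first.
  by apply: measurable_funTS; exact/measurable_EFinP.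
pose F (x : R) := - n%:~R^-1 * cas (- n%:~R * x - c).
have dF (x : R) : is_derive x 1 F (cas (n%:~R * x + c)).
  have := is_derive_cas_affine (- n%:~R) (- c) x.
  move=> d; rewrite /F; apply: is_derive_eq.
  rewrite /GRing.scale/= (_ : - (- n%:~R * x - c) = n%:~R * x + c); last by ring.
  by rewrite mulrA mulrNN mulVf// mul1r.
rewrite (@continuous_FTC2 _ _ F 0 (2 * pi))//.
- rewrite /F mulr0 add0r -EFinB -[in X in X - _](cas_periodz _ n).
  by rewrite (_ : - n%:~R * (2 * pi) - c + n%:~R * (2 * pi) = - c) ?subrr//; ring.
- exact: continuous_subspaceT.
- split.
  + by move=> x _; have [] := dF x.
  + apply: cvg_at_right_filter; apply: differentiable_continuous.
    by apply/derivable1_diffP; have [] := dF 0.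
  + apply: cvg_at_left_filter; apply: differentiable_continuous.
    by apply/derivable1_diffP; have [] := dF (2 * pi).
- by move=> x _; rewrite derive1E; have [_ ->] := dF x.
Qed.

Lemma measurable_mode k :
  measurable_fun setT (mode k : measurableTypeR R * measurableTypeR R -> R).
Proof.
apply: measurableT_comp; first exact: measurable_cas.
by apply: measurable_funD; exact: measurable_funM.
Qed.

Lemma mode_L2 k : L2 (mode k).
Proof.
split; first exact: mode_periodic.
have cst2 : cst 1 \in Lfun mu 2%:E.
  apply/Lfun2P; split => //; under eq_integral do rewrite expr1n.
  by rewrite integral_cst// mul1e; exact: torus_finite.
have := Lfun2_bounded_mul (measurable_mode k) (aeW _ (fun x => cas_bound _)) cst2.
rewrite (_ : (fun _ => _) = mode k)//.
by apply/funext => x; rewrite mul1r.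
Qed.

Lemma integral_mode k : \int[mu]_x mode k x = (k == 0)%:R * (2 * pi) ^+ 2.
Proof.
have ik : (lam \x lam)%E.-integrable setT (EFin \o mode k).
  apply/torus_integrableE; apply: measurable_bounded_integrable => //.
  - exact: torus_finite.
  - exact: measurable_mode.
  - exact: bounded_setT (fun x => cas_bound _).
rewrite /Rintegral torus_integralE.
have [k2|k2] := eqVneq k.2 0; last first.
  have -> : (k == 0) = false by apply/negbTE; apply: contra k2 => /eqP ->.
  rewrite -(integral12_prod_meas1 ik) mul0r -[RHS]/(fine 0%E).
  congr fine; rewrite -[RHS](integral0 lam setT); apply: eq_integral => x _.
  rewrite -[RHS](integral_period_cas (k.1%:~R * x) k2); apply: eq_integral => y _.
  by rewrite /mode /phase /= addrC.
have [k1|k1] := eqVneq k.1 0; last first.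
  have -> : (k == 0) = false by apply/negbTE; apply: contra k1 => /eqP ->.
  rewrite -(integral21_prod_meas1 ik) mul0r -[RHS]/(fine 0%E).
  congr fine; rewrite -[RHS](integral0 lam setT); apply: eq_integral => y _.
  by rewrite -[RHS](integral_period_cas (k.2%:~R * y) k1); apply: eq_integral.
have -> : k == 0 by apply/eqP; case: k k1 k2 {ik} => a b /= -> ->.
rewrite -torus_integralE mul1r; transitivity (fine (\int[mu]_x (cst 1%E) x)).
  by congr fine; apply: eq_integral => x _; rewrite /= /mode /phase k1 k2 !mul0r addr0 cas0.
by rewrite integral_cst// mul1e torus_mass.
Qed.

(** The products of modes are combinations of modes, so that orthogonality
    reduces to the integral of a single mode. *)
Lemma modeM k l x : mode k x * mode l x =
  2^-1 * (mode (k - l) x + mode (l - k) x + mode (k + l) x - mode (- (k + l)) x).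
Proof.
rewrite /mode casM_cas phaseN !phaseD !phaseN; congr (_ * (_ - cas _)); ring.
Qed.

Lemma integral_modeM k l :
  \int[mu]_x (mode k x * mode l x) = (k == l)%:R * (2 * pi) ^+ 2.
Proof.
have ik n : mu.-integrable setT (EFin \o mode n).
  apply: measurable_bounded_integrable => //.
  - exact: torus_finite.
  - exact: measurable_mode.
  - exact: bounded_setT (fun x => cas_bound _).
have i2 := integrableD measurableT (ik (k - l)) (ik (l - k)).
have i3 := integrableD measurableT i2 (ik (k + l)).
have i4 := integrableB measurableT i3 (ik (- (k + l))).
under eq_Rintegral do rewrite modeM.
rewrite RintegralZl// RintegralB// RintegralD// RintegralD// !integral_mode.
by rewrite oppr_eq0 -[l - k]opprB oppr_eq0 subr_eq0; field.
Qed.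

End Modes.

(** * Gradients of test functions are square integrable *)

Section Gradient.
Context {R : realType}.
Local Notation mu := (@torus_measure R).
Local Notation R2 := (measurableTypeR R * measurableTypeR R)%type.

(** Freezing the first variable on a grid of step 1 / (n + 1) gives functions
    that are measurable for the product sigma-algebra and converge pointwise. *)
Lemma continuous_measurable2 (g : R * R -> R) :
  continuous g -> measurable_fun setT (g : R2 -> R).
Proof.
move=> cg.
pose q (n : nat) (x : R) : int := Num.floor (x * n.+1%:R).
pose h n (z : R2) := g ((q n z.1)%:~R / n.+1%:R, z.2) : R.
have n0 n : 0 < n.+1%:R :> R by rewrite ltr0n.
apply: (@measurable_fun_cvg _ _ _ _ h).
  move=> n _ Y mY; rewrite setTI.
  have -> : h n @^-1` Y = \bigcup_(k : int)
      ([set x | k%:~R <= x * n.+1%:R < (k + 1)%:~R] `*`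
       [set y | Y (g (k%:~R / n.+1%:R, y))]).
    apply/seteqP; split => -[x y] /=.
      move=> Yh; exists (q n x) => //=; split => //.
      exact: floor_itv.
    by move=> [k _ /=[/floor_def qk]]; rewrite /h /q /= qk.
  apply: countable_bigcupT_measurable => // k; apply: measurableX.
    rewrite (_ : [set x | _] = `[k%:~R / n.+1%:R, (k + 1)%:~R / n.+1%:R[%classic).
      exact: measurable_itv.
    by apply/seteqP; split => x /=; rewrite in_itv/= ler_pdivrMr// ltr_pdivlMr.
  rewrite -[X in measurable X]setTI.
  have mgk : measurable_fun setT (fun y : R => g (k%:~R / n.+1%:R, y)).
    apply: continuous_measurable_fun => y.
    have pc : (k%:~R / n.+1%:R : R, t) @[t --> y] --> (k%:~R / n.+1%:R : R, y).
      exact: (cvg_pair (cvg_cst _) cvg_id).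
    exact: (cvg_comp _ _ pc (cg (k%:~R / n.+1%:R, y))).
  exact: mgk.
move=> [x y] _; rewrite /h /=.
have qx : (q n x)%:~R / n.+1%:R @[n --> \oo] --> x.
  apply: (@squeeze_cvgr _ _ _ _ (fun n => x - n.+1%:R^-1) (cst x)).
  - apply: nearW => n; have /andP[h1] := floor_itv (x * n.+1%:R).
    rewrite rmorphD/= -/(q n x) => h2.
    rewrite ler_pdivrMr// h1 andbT ler_pdivlMr// mulrBl mulVf ?gt_eqF//.
    by rewrite lerBlDr ltW.
  - rewrite -[X in _ --> X]subr0; apply: cvgB; first exact: cvg_cst.
    exact: cvg_harmonic.
  - exact: cvg_cst.
have pc : ((q n x)%:~R / n.+1%:R : R, y) @[n --> \oo] --> (x, y).
  exact: (cvg_pair qx (cvg_cst _)).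
exact: (cvg_comp _ _ pc (cg (x, y))).
Qed.

Lemma test_function_grad_L2 (phi : R * R -> R) (i : 'I_2) :
  test_function phi -> L2 ('D_(dir i) phi).
Proof.
move=> [pphi sphi]; set g := 'D_(dir i) phi.
have cg : continuous g by have [_] := sphi 1%N i.
have mg := continuous_measurable2 cg.
have translate (a x : R * R) : (forall y, phi (y + a) = phi y) -> g (x + a) = g x.
  move=> pa; rewrite /g /derive.
  rewrite (_ : (fun h => h^-1 *: ((phi \o shift (x + a)) (h *: dir i) - phi (x + a))) =
    (fun h => h^-1 *: ((phi \o shift x) (h *: dir i) - phi x)))//.
  by apply/funext => h; rewrite /= addrA !pa.
have pg : torus_periodic g.
  move=> [x y]; split=> /=.
    rewrite -(translate (2 * pi, 0) (x, y)); last first.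
      by move=> z; have [<- _] := pphi z; congr phi; case: z => a b; congr pair; exact: addr0.
    by congr g; congr pair; rewrite /= addr0.
  rewrite -(translate (0, 2 * pi) (x, y)); last first.
    by move=> z; have [_ <-] := pphi z; congr phi; case: z => a b; congr pair; exact: addr0.
  by congr g; congr pair; rewrite /= addr0.
split=> //.
have [M gM] : exists M : R, forall x, cell x -> `|g x| <= M.
  pose K : set (R * R) := `[0, 2 * pi] `*` `[0, 2 * pi].
  have cK : compact K by apply: compact_setX; exact: segment_compact.
  have : compact (g @` K).
    by apply: continuous_compact => //; exact: continuous_subspaceT.
  move=> /compact_bounded[M [_ MP]]; exists (M + 1) => x [/= x1 x2].
  apply: (MP (M + 1)); first by rewrite ltrDl.
  exists x => //; split => /=; rewrite in_itv/=; [move: x1|move: x2];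
    by rewrite in_itv/= => /andP[-> /ltW].
have [p1 cst2] : L2 (cst 1 : R * R -> R).
  rewrite (_ : cst 1 = mode 0); first exact: mode_L2.
  by apply/funext => x; rewrite /mode /phase !mul0r addr0 cas0.
have aeM : {ae mu, forall x, `|g x| <= M}.
  by apply: ae_mrestr; apply: aeW => x; exact: gM.
have := Lfun2_bounded_mul mg aeM cst2.
by rewrite (_ : (fun _ => _) = g)//; apply/funext => x; rewrite mul1r.
Qed.

End Gradient.

(** * The Hilbert space of square integrable fields *)

Section Fields.
Context {R : realType}.
Local Notation mu := (@torus_measure R).
Local Notation R2 := (measurableTypeR R * measurableTypeR R)%type.
Local Notation field := (R * R -> 'rV[R]_2).

Lemma L2_lin a (f g : R * R -> R) : L2 f -> L2 g -> L2 (fun x => a * f x + g x).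
Proof.
move=> [pf f2] [pg g2]; split; last exact: Lfun2_lin.
by move=> x; have [-> ->] := pf x; have [-> ->] := pg x.
Qed.

Lemma L2_mul_integrable (f g : R * R -> R) : L2 f -> L2 g ->
  mu.-integrable setT (EFin \o (fun x => f x * g x)).
Proof. by move=> [_ f2] [_ g2]; exact: Lfun2M_integrable. Qed.

Lemma Rintegral_sumord (n : nat) (f : 'I_n -> R2 -> R) :
  (forall i, mu.-integrable setT (EFin \o f i)) ->
  mu.-integrable setT (EFin \o (fun x => \sum_i f i x)) /\
  \int[mu]_x (\sum_i f i x) = \sum_i \int[mu]_x f i x.
Proof.
elim: n f => [|n IH] f fi.
  rewrite big_ord0 (_ : (fun x => \sum_i f i x) = cst 0); last first.
    by apply/funext => x; rewrite big_ord0.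
  split; first exact: integrable0.
  by rewrite /Rintegral integral0.
have [iS eS] := IH (fun i => f (lift ord0 i)) (fun i => fi _).
rewrite (_ : (fun x => \sum_i f i x) =
  (fun x => f ord0 x + \sum_i f (lift ord0 i) x)); last first.
  by apply/funext => x; rewrite big_ord_recl.
split; first exact: (integrableD measurableT (fi ord0) iS).
by rewrite RintegralD// eS big_ord_recl.
Qed.

Definition L2field : set field := [set e | forall i, L2 (component e i)].

Definition ip (u v : field) : R := \int[mu]_x dot (u x) (v x).

Lemma dot_integrable u v : L2field u -> L2field v ->
  mu.-integrable setT (EFin \o (fun x => dot (u x) (v x))).
Proof.
move=> Eu Ev; have [] := @Rintegral_sumord 2 (fun i x => component u i x * component v i x).
  by move=> i; exact: L2_mul_integrable.
by [].
Qed.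

Lemma ipE u v : L2field u -> L2field v ->
  ip u v = \sum_i \int[mu]_x (component u i x * component v i x).
Proof.
move=> Eu Ev; have [] := @Rintegral_sumord 2 (fun i x => component u i x * component v i x).
  by move=> i; exact: L2_mul_integrable.
by [].
Qed.

Lemma L2field_complete (u : nat -> field) : (forall n, L2field (u n)) ->
  (forall eps, 0 < eps -> exists N, forall m n, (N <= m)%N -> (N <= n)%N ->
    ip (u m - u n) (u m - u n) <= eps) ->
  exists2 l, L2field l & forall eps, 0 < eps -> exists N, forall n, (N <= n)%N ->
    ip (u n - l) (u n - l) <= eps.
Proof.
move=> Eu uC.
have EB v w : L2field v -> L2field w -> L2field (v - w).
  move=> Ev Ew i; rewrite (_ : component _ i =
    (fun x => -1 * component w i x + component v i x)); first exact: L2_lin.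
  by apply/funext => x; rewrite /component !mxE mulN1r addrC.
have compB v w i x : component (v - w) i x = component v i x - component w i x.
  by rewrite /component !mxE.
have /choice[l lP] i : exists f, [/\ f \in Lfun mu 2%:E,
    forall x y, (forall n, component (u n) i x = component (u n) i y) -> f x = f y &
    forall eps, 0 < eps -> exists N, forall n, (N <= n)%N ->
      \int[mu]_x ((component (u n) i x - f x) ^+ 2) <= eps].
  apply: Lfun2_complete; first by move=> n; exact: (Eu n i).2.
  move=> eps e0; have [N NP] := uC _ e0; exists N => m n Nm Nn.
  apply: le_trans (NP m n Nm Nn); rewrite ipE; [|exact: EB..].
  rewrite (bigD1 i)//= (_ : (fun x => _ ^+ 2) =
    (fun x => component (u m - u n) i x * component (u m - u n) i x)).
    rewrite lerDl; apply: sumr_ge0 => j _; apply: Rintegral_ge0 => x _.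
    by rewrite -expr2 sqr_ge0.
  by apply/funext => x; rewrite compB.
pose L : field := fun x => \row_i l i x.
have compL i : component L i = l i by apply/funext => x; rewrite /component mxE.
have EL : L2field L.
  move=> i; have [l2 lp _] := lP i; rewrite compL; split => //.
  by move=> x; split; apply: lp => n; have [p _] := Eu n i; have [] := p x.
exists L => // eps e0.
have /choice[N NP] i : exists N, forall n, (N <= n)%N ->
    \int[mu]_x ((component (u n) i x - l i x) ^+ 2) <= eps / 2.
  by have [_ _ lim] := lP i; apply: lim; rewrite divr_gt0.
exists (maxn (N 0) (N 1)) => n; rewrite geq_max => /andP[N0n N1n].
rewrite ipE; [|exact: EB..].
have key i : (N i <= n)%N ->
    \int[mu]_x (component (u n - L) i x * component (u n - L) i x) <= eps / 2.
  move=> /NP; rewrite (_ : (fun x => _ ^+ 2) =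
    (fun x => component (u n - L) i x * component (u n - L) i x))//.
  by apply/funext => x; rewrite compB compL.
have h0 := key _ N0n; have h1 := key _ N1n.
rewrite !big_ord_recl big_ord0 addr0.
rewrite [leRHS](_ : eps = eps / 2 + eps / 2); last by field.
apply: lerD => //.
by rewrite (_ : lift ord0 ord0 = 1)//; exact/val_inj.
Qed.

Lemma hilbert_L2field : hilbert L2field ip.
Proof.
have comp_lin a (u v : field) i :
    component (a *: u + v) i = (fun x => a * component u i x + component v i x).
  by apply/funext => x; rewrite /component !mxE.
have Elin a u v : L2field u -> L2field v -> L2field (a *: u + v).
  by move=> Eu Ev i; rewrite comp_lin; exact: L2_lin.
split=> //.
- move=> i; split; first by move=> x; rewrite /component !mxE.
  rewrite (_ : component 0 i = cst 0); last by apply/funext => x; rewrite /component !mxE.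
  apply/Lfun2P; split => //.
  under eq_integral do rewrite expr0n/=.
  by rewrite integral0.
- move=> u v Eu Ev; rewrite !ipE//; apply: eq_bigr => i _.
  by apply: eq_Rintegral => x _; rewrite mulrC.
- move=> a u v w Eu Ev Ew; rewrite !ipE//; last exact: Elin.
  rewrite mulr_sumr -big_split/=; apply: eq_bigr => i _.
  have iu := L2_mul_integrable (Eu i) (Ew i); have iv := L2_mul_integrable (Ev i) (Ew i).
  rewrite -RintegralZl// -RintegralD//; last exact: (integrableZl measurableT _ iu).
  by apply: eq_Rintegral => x _; rewrite comp_lin; ring.
- move=> u Eu; rewrite ipE//; apply: sumr_ge0 => i _; apply: Rintegral_ge0 => x _.
  by rewrite -expr2 sqr_ge0.
- exact: L2field_complete.
Qed.

Lemma L2norm_sqrt (g : R2 -> R) : mu.-integrable setT (EFin \o g) ->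
  (forall x, 0 <= g x) ->
  L2norm (fun x => Num.sqrt (g x)) ^+ 2 = \int[mu]_x g x.
Proof.
move=> ig g0; have mg : measurable_fun setT g by case/integrableP: ig => /measurable_EFinP.
have sq x : Num.sqrt (g x) ^+ 2 = g x by rewrite sqr_sqrtr.
rewrite /L2norm sqr_Lnorm2; first by apply: eq_Rintegral => x _; rewrite sq.
apply/Lfun2P; split.
  have msqrt : measurable_fun setT (Num.sqrt : R -> R).
    by apply: continuous_measurable_fun; exact: sqrt_continuous.
  exact: (measurableT_comp msqrt mg).
under eq_integral do rewrite sq.
case/integrableP: ig => _; apply: le_lt_trans; apply: ge0_le_integral => //.
- by move=> x _; rewrite lee_fin.
- exact/measurable_EFinP.
- by apply: measurableT_comp => //; exact/measurable_EFinP.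
- by move=> x _ /=; rewrite lee_fin ler_norm.
Qed.

Lemma L2norm_euclid e : L2field e -> L2norm (fun x => euclid (e x)) ^+ 2 = ip e e.
Proof.
move=> Ee; rewrite /ip -L2norm_sqrt.
- congr (L2norm _ ^+ 2); apply/funext => x; rewrite /euclid big_ord1; congr Num.sqrt.
- exact: dot_integrable.
- by move=> x; apply: sumr_ge0 => j _; rewrite -expr2 sqr_ge0.
Qed.

End Fields.

(** * Low frequencies control the norm up to the gradient *)

Section Spectrum.
Context {R : realType}.
Local Notation mu := (@torus_measure R).
Local Notation field := (R * R -> 'rV[R]_2).
Local Notation index := ((int * int) * 'I_2)%type.
Implicit Types (k : index) (e : field).

Lemma L2_scale a (f : R * R -> R) : L2 f -> L2 (fun x => a * f x).
Proof.
move=> f2; rewrite (_ : (fun _ => _) = (fun x => (a - 1) * f x + f x)).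
  exact: L2_lin.
by apply/funext => x; ring.
Qed.

Definition vmode k : field :=
  fun x => \row_j ((j == k.2)%:R * (2 * pi)^-1 * mode k.1 x).

Lemma vmode_L2 k : L2field (vmode k).
Proof.
move=> i; rewrite (_ : component _ i = (fun x => ((i == k.2)%:R * (2 * pi)^-1) * mode k.1 x)).
  exact: L2_scale (mode_L2 _).
by apply/funext => x; rewrite /component mxE.
Qed.

Lemma ip_vmode e k : L2field e ->
  ip e (vmode k) = (2 * pi)^-1 * \int[mu]_x (component e k.2 x * mode k.1 x).
Proof.
move=> Ee; rewrite ipE//; last exact: vmode_L2.
rewrite (bigD1 k.2)//= [X in _ + X]big1 ?addr0.
  rewrite -RintegralZl//; last exact: L2_mul_integrable (Ee _) (mode_L2 _).
  apply: eq_Rintegral => x _.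
  rewrite (_ : component (vmode k) k.2 x = (2 * pi)^-1 * mode k.1 x); first by ring.
  by rewrite /component mxE eqxx mul1r.
move=> i ik; rewrite /Rintegral -[RHS]/(fine 0%E); congr fine.
rewrite -[RHS](integral0 mu setT); apply: eq_integral => x _.
by rewrite /component mxE (negbTE ik) !mul0r mulr0.
Qed.

Lemma vmode_orthonormal k l : ip (vmode k) (vmode l) = (k == l)%:R.
Proof.
have pi0 : 2 * pi != 0 :> R by rewrite mulf_neq0 ?gt_eqF ?pi_gt0.
rewrite ip_vmode; last exact: vmode_L2.
have -> : \int[mu]_x (component (vmode k) l.2 x * mode l.1 x) =
    ((l.2 == k.2)%:R * (2 * pi)^-1) * \int[mu]_x (mode k.1 x * mode l.1 x).
  rewrite -RintegralZl//; last exact: L2_mul_integrable (mode_L2 _) (mode_L2 _).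
  by apply: eq_Rintegral => x _; rewrite /component mxE mulrA.
rewrite integral_modeM [l.2 == _]eq_sym; case: k l => [k i] [l j] /=.
rewrite xpair_eqE; case: (k == l); case: (i == j) => /=; rewrite ?(mul0r, mulr0, mul1r)//.
by rewrite expr2 mulKf// mulVf.
Qed.

Lemma vmode_total e : L2field e -> (forall k, ip e (vmode k) = 0) -> ip e e = 0.
Proof.
move=> Ee e0; rewrite ipE// big1// => i _.
have pi0 : 2 * pi != 0 :> R by rewrite mulf_neq0 ?gt_eqF ?pi_gt0.
have ae0 : {ae mu, forall x, component e i x = 0}.
  apply: torus_uniqueness.
    apply/Lfun1_integrable; apply: Lfun_subset12 (Ee i).2.
    by rewrite ge0_fin_numE// torus_finite.
  move=> a b; have := e0 ((a, b), i); rewrite ip_vmode//= => /eqP.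
  by rewrite mulf_eq0 invr_eq0 (negbTE pi0) => /eqP.
rewrite /Rintegral -[RHS]/(fine 0%E); congr fine.
rewrite -[RHS](integral0 mu setT); apply: ae_eq_integral => //.
  by case/integrableP: (L2_mul_integrable (Ee i) (Ee i)).
apply: (@filterS _ _ (ae_filter_ringOfSetsType mu) _ _ _ ae0) => x -> _.
by rewrite mul0r.
Qed.

(** The j-th column of the gradient is treated as a field of its own, so that
    Bessel's inequality applies to it. *)
Definition grad_col e (j : 'I_2) : field :=
  fun x => \row_i weak_partial j (component e i) x.

Lemma weak_partialP (f : R * R -> R) j : H1 f ->
  L2 (weak_partial j f) /\ is_weak_partial j f (weak_partial j f).
Proof. by move=> [_ /(_ j) ex]; exact: xgetPex ex. Qed.

Lemma component_grad_col e i j :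
  component (grad_col e j) i = weak_partial j (component e i).
Proof. by apply/funext => x; rewrite /component mxE. Qed.

Lemma grad_col_L2 e j : (forall i, H1 (component e i)) -> L2field (grad_col e j).
Proof. by move=> He i; rewrite component_grad_col; have [] := weak_partialP j (He i). Qed.

Lemma Vnorm_grad_col e : (forall i, H1 (component e i)) ->
  Vnorm e ^+ 2 = \sum_j ip (grad_col e j) (grad_col e j).
Proof.
move=> He; have EG j := grad_col_L2 j He.
pose F (i j : 'I_2) (x : R * R) : R :=
  component (grad_col e j) i x * component (grad_col e j) i x.
have iF i j : mu.-integrable setT (EFin \o F i j).
  exact: L2_mul_integrable (EG j i) (EG j i).
have [iS eS] := Rintegral_sumord (fun i => (Rintegral_sumord (iF i)).1).
rewrite /Vnorm (_ : (fun x => _) = (fun x => Num.sqrt (\sum_i \sum_j F i j x))).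
  rewrite L2norm_sqrt//; last first.
    by move=> x; apply: sumr_ge0 => i _; apply: sumr_ge0 => j _; rewrite /F -expr2 sqr_ge0.
  rewrite eS; under eq_bigr => i _ do rewrite (Rintegral_sumord (iF i)).2.
  by rewrite exchange_big; apply: eq_bigr => j _; rewrite ipE.
apply/funext => x; rewrite /euclid; congr Num.sqrt; apply: eq_bigr => i _.
by apply: eq_bigr => j _; rewrite /F component_grad_col mxE expr2.
Qed.

Definition opp_index k : index := (- k.1, k.2).

(** The definition of the weak derivative tested on a mode.  Frequencies change
    sign because the derivative of cas is evaluated at the opposite argument. *)
Lemma ip_grad_col e j k : (forall i, H1 (component e i)) -> L2field e ->
  ip (grad_col e j) (vmode (opp_index k)) = (freq j k.1)%:~R * ip e (vmode k).
Proof.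
move=> He Ee; rewrite !ip_vmode//; last exact: grad_col_L2.
rewrite mulrCA /=; congr (_ * _).
have [_ /(_ _ (test_mode (- k.1))) wp] := weak_partialP j (He k.2).
rewrite component_grad_col -[LHS]opprK -wp -RintegralZl//; last first.
  exact: L2_mul_integrable (Ee _) (mode_L2 _).
rewrite -mulN1r -RintegralZl//; last first.
  apply: L2_mul_integrable (Ee _) _; rewrite D_mode; exact: L2_scale (mode_L2 _).
apply: eq_Rintegral => x _.
have -> : 'D_(dir j) (mode (- k.1)) x = (freq j (- k.1))%:~R * mode k.1 x.
  by have /= := congr1 (fun f => f x) (D_mode (- k.1) j); rewrite opprK.
by rewrite /freq; case: ifP => _ /=; rewrite rmorphN/=; ring.
Qed.

Lemma sum_subset (I : eqType) (s t : seq I) (F : I -> R) : (forall x, 0 <= F x) ->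
  uniq s -> {subset s <= t} -> \sum_(x <- s) F x <= \sum_(x <- t) F x.
Proof.
move=> F0; elim: s t => [|a s IH] t; first by rewrite big_nil sumr_ge0.
move=> /= /andP[as_ us] st; rewrite big_cons [leRHS](big_rem a)/=; last first.
  by apply: st; rewrite mem_head.
rewrite lerD2l; apply: IH => // b bs.
have : b \in t by apply: st; rewrite inE bs orbT.
have ba : b != a by apply: contraNneq as_ => <-.
by rewrite (perm_mem (perm_to_rem (st a (mem_head _ _)))) inE (negbTE ba).
Qed.

Definition in_box (N : nat) k := (`|k.1.1| <= N)%N && (`|k.1.2| <= N)%N.

Definition axis (N : nat) : seq int := [seq n%:Z - N%:Z | n <- iota 0 (N + N).+1].

Definition box (N : nat) : seq index :=
  [seq (ab, i) | ab <- [seq (a, b) | a <- axis N, b <- axis N], i <- enum 'I_2].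

Lemma mem_axis N (a : int) : (`|a| <= N)%N -> a \in axis N.
Proof.
move=> aN; apply/mapP; exists `|(a + N%:Z)%R|%N; last lia.
by rewrite mem_iota; lia.
Qed.

Lemma mem_box N k : in_box N k -> k \in box N.
Proof.
case: k => [[a b] i] /andP[/= aN bN].
by apply: allpairs_f; [apply: allpairs_f; exact: mem_axis|exact: mem_enum].
Qed.

(** Outside the box some frequency is at least N + 1 in absolute value, so there
    (N + 1)^2 <e, b_k>^2 is at most the sum over j of the squared coefficients of
    the columns of the gradient, and Bessel's inequality bounds their sum. *)
Lemma low_frequency N e : (forall i, H1 (component e i)) -> L2field e ->
  ip e e <= \sum_(k <- box N) ip e (vmode k) ^+ 2 + N.+1%:R ^- 2 * Vnorm e ^+ 2.
Proof.
move=> He Ee; apply/ler_addgt0Pr => d d0.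
have [s us sP] := parseval_approx hilbert_L2field vmode_L2 vmode_orthonormal vmode_total Ee d0.
apply: le_trans sP _; rewrite lerD2r (bigID (in_box N))/=; apply: lerD.
  rewrite -big_filter; apply: sum_subset.
  - by move=> k; exact: sqr_ge0.
  - exact: filter_uniq.
  - by move=> k; rewrite mem_filter => /andP[/mem_box].
have N0 : 0 < N.+1%:R ^+ 2 :> R by rewrite exprn_gt0.
rewrite mulrC ler_pdivlMr// mulr_suml Vnorm_grad_col//.
apply: (@le_trans _ _ (\sum_(k <- s) \sum_j ((freq j k.1)%:~R * ip e (vmode k)) ^+ 2)).
  rewrite [leRHS](bigID (in_box N))/= -[leLHS]add0r; apply: lerD.
    by apply: sumr_ge0 => k _; apply: sumr_ge0 => j _; exact: sqr_ge0.
  apply: ler_sum => k; rewrite /in_box negb_and -!ltnNge => kN.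
  rewrite big_ord_recl big_ord1 !exprMn -mulrDl mulrC ler_wpM2r ?sqr_ge0//.
  have big (a : int) : (N < `|a|)%N -> N.+1%:R ^+ 2 <= (a%:~R : R) ^+ 2.
    move=> Na; rewrite -[leRHS]real_normK ?num_real// lerXn2r ?nnegrE//.
    by rewrite -intr_norm -abszE -pmulrn ler_nat.
  rewrite /freq /=; case/orP: kN => /big h; apply: le_trans h _.
    by rewrite lerDl sqr_ge0.
  by rewrite lerDr sqr_ge0.
rewrite exchange_big; apply: ler_sum => j _.
have ut : uniq (map opp_index s).
  rewrite map_inj_uniq//; apply: (can_inj (g := opp_index)) => -[k i].
  by rewrite /opp_index /= opprK.
have := bessel hilbert_L2field vmode_L2 vmode_orthonormal ut (grad_col_L2 j He).
rewrite big_map; apply: le_trans; rewrite le_eqVlt; apply/orP; left; apply/eqP.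
by apply: eq_bigr => k _; rewrite ip_grad_col.
Qed.

End Spectrum.

(** * One coefficient is controlled by the component along m *)

Section Control.
Context {R : realType} (m : R * R -> 'rV[R]_2).
Local Notation mu := (@torus_measure R).
Local Notation field := (R * R -> 'rV[R]_2).
Hypotheses (m_Linfty : forall i, Linfty (component m i))
  (m_unit : {ae mu, forall x, euclid (m x) = 1})
  (K_trivial : forall e, spaceK m e -> {ae mu, forall x, e x = 0}).

Lemma L2_mul_m (f : R * R -> R) i : L2 f -> L2 (fun x => f x * component m i x).
Proof.
move=> [pf f2]; have [pm mi] := m_Linfty i; split.
  by move=> x; have [-> ->] := pf x; have [-> ->] := pm x.
apply: (Lfun2_bounded_mul (M := 1)) f2.
  by move: mi; rewrite inE => /andP[]; rewrite inE.
apply: (@filterS _ _ (ae_filter_ringOfSetsType mu) _ _ _ m_unit) => x mx.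
rewrite -mx /euclid big_ord1 -sqrtr_sqr ler_sqrt; last first.
  by apply: sumr_ge0 => j _; exact: sqr_ge0.
by rewrite (bigD1 i)//= lerDl; apply: sumr_ge0 => j _; exact: sqr_ge0.
Qed.

Lemma L2_dot_m e : L2field e -> L2 (fun x => dot (e x) (m x)).
Proof.
move=> Ee; rewrite (_ : (fun x => _) = (fun x => 1 * (component e 0 x * component m 0 x)
    + component e 1 x * component m 1 x)).
  by apply: L2_lin; exact: L2_mul_m.
apply/funext => x; rewrite /dot !big_ord_recl big_ord0 mul1r addr0.
by rewrite (_ : lift ord0 ord0 = 1)//; exact/val_inj.
Qed.

Lemma L2field_mul_m psi : L2 psi -> L2field (fun x => psi x *: m x).
Proof.
move=> p2 i; rewrite (_ : component _ i = (fun x => psi x * component m i x)).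
  exact: L2_mul_m.
by apply/funext => x; rewrite /component mxE.
Qed.

Lemma ip_mul_m e psi : ip e (fun x => psi x *: m x) =
  \int[mu]_x (dot (e x) (m x) * psi x).
Proof.
apply: eq_Rintegral => x _; rewrite /dot mulr_suml; apply: eq_bigr => i _.
by rewrite mxE; ring.
Qed.

(** H is cut out by the orthogonality to gradients of test functions and to
    constants, and these are square integrable fields orthogonal to H. *)
Lemma spaceH_bipolar (r : field) : L2field r ->
  (forall h, L2field h -> (forall e : field, spaceH e -> ip e h = 0) -> ip r h = 0) ->
  spaceH r.
Proof.
move=> Er rperp; split=> //; split.
  move=> phi tphi; pose h : field := fun x => \row_i 'D_(dir i) phi x.
  have ipD e : ip e h = \int[mu]_x (\sum_i component e i x * 'D_(dir i) phi x).
    by apply: eq_Rintegral => x _; apply: eq_bigr => i _; rewrite mxE.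
  rewrite -ipD; apply: rperp.
    move=> i; rewrite (_ : component h i = 'D_(dir i) phi).
      exact: test_function_grad_L2.
    by apply/funext => x; rewrite /component mxE.
  by move=> e [_ [div _]]; rewrite ipD; exact: div.
move=> i; pose h : field := fun=> \row_j (j == i)%:R.
have ipc e : ip e h = \int[mu]_x component e i x.
  apply: eq_Rintegral => x _; rewrite /dot (bigD1 i)//= mxE eqxx mulr1 big1 ?addr0//.
  by move=> j ji; rewrite mxE (negbTE ji) mulr0.
rewrite -ipc; apply: rperp; last by move=> e [_ [_ mean]]; rewrite ipc; exact: mean.
move=> j; rewrite (_ : component h j = (fun x => (j == i)%:R * mode 0 x)).
  exact: L2_scale (mode_L2 _).
by apply/funext => x; rewrite /component mxE /mode /phase !mul0r addr0 cas0 mulr1.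
Qed.

(** Density of the fields psi m + h, with h orthogonal to H; the triviality of
    K_m is exactly the vanishing of their orthogonal complement. *)
Lemma control_pairing phi (eps : R) : L2field phi -> 0 < eps ->
  exists C, forall e : field, spaceH e ->
    ip e phi ^+ 2 <= C * L2norm (fun x => dot (e x) (m x)) ^+ 2 + eps * ip e e.
Proof.
move=> Ephi e0.
have hE := @hilbert_L2field R.
pose Hperp : set field := [set h | L2field h /\ forall e : field, spaceH e -> ip e h = 0].
pose Y : set field := [set y | exists psi h, [/\ L2 psi, Hperp h &
  y = (fun x => psi x *: m x) + h]].
have L20 : L2 (cst 0 : R * R -> R).
  have := hilbert0 hE 0; rewrite (_ : component 0 0 = cst 0)//.
  by apply/funext => x; rewrite /component mxE.
have Hperp0 : Hperp 0.
  split; first exact: hilbert0 hE.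
  by move=> e [Ee _]; rewrite (ipC hE) ?(ip0l hE)//; exact: hilbert0 hE.
have YE : Y `<=` L2field.
  by move=> y [psi [h [p2 [Eh _] ->]]]; apply: (hilbertD hE) => //; exact: L2field_mul_m.
have Y0 : Y 0.
  exists (cst 0), 0; split => //.
  by apply/funext => x; rewrite addr0 scale0r.
have YP a u v : Y u -> Y v -> Y (a *: u + v).
  move=> [p [h [p2 [Eh h0] ->]]] [p' [h' [p2' [Eh' h0'] ->]]].
  exists (fun x => a * p x + p' x), (a *: h + h'); split.
  - exact: L2_lin.
  - split; first exact: hilbertP hE _ _ _ Eh Eh'.
    move=> e He; have [Ee _] := He.
    rewrite (ipDr hE)//; last exact: hilbertZ hE _ _ Eh.
    by rewrite (ipZr hE)// h0// h0'// mulr0 addr0.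
  - by apply/funext => x; rewrite !fctE scalerDr scalerDl scalerA addrACA.
have perp0 r : L2field r -> (forall y, Y y -> ip r y = 0) -> ip r r = 0.
  move=> Er rY.
  have Hr : spaceH r.
    apply: spaceH_bipolar => // h Eh hH; apply: rY.
    exists (cst 0), h; split => //.
    by apply/funext => x; rewrite !fctE scale0r add0r.
  have rm := L2_dot_m Er.
  have : ip r (fun x => dot (r x) (m x) *: m x) = 0.
    by apply: rY; exists (fun x => dot (r x) (m x)), 0; split => //; rewrite addr0.
  rewrite ip_mul_m => rm0.
  have /K_trivial r0 : spaceK m r.
    split=> //; apply: Rintegral_sqr_eq0 rm.2 _.
    by rewrite -[RHS]rm0; apply: eq_Rintegral => x _; rewrite expr2.
  rewrite /ip /Rintegral -[RHS]/(fine 0%E); congr fine.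
  rewrite -[RHS](integral0 mu setT); apply: ae_eq_integral => //.
    by case/integrableP: (dot_integrable Er Er).
  apply: (@filterS _ _ (ae_filter_ringOfSetsType mu) _ _ _ r0) => x -> _.
  by rewrite /dot big1// => i _; rewrite mxE mul0r.
have [_ [psi [h [p2 [Eh hH] ->]]]] :=
  dense_of_perp0 hE YE Y0 YP perp0 Ephi (divr_gt0 e0 (ltr0n _ 2)).
set y := _ + h => yd.
have Ep := L2field_mul_m p2.
exists (2 * \int[mu]_x (psi x ^+ 2)) => e He; have [Ee _] := He.
have Ew : L2field (phi - y).
  by apply: (hilbertB hE) => //; apply: (hilbertD hE).
have em := L2_dot_m Ee.
have -> : ip e phi = ip e (phi - y) + \int[mu]_x (dot (e x) (m x) * psi x).
  rewrite -{1}(subrK y phi) (ipDr hE)//; last exact: (hilbertD hE).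
  by rewrite [ip e y](ipDr hE)// hH// addr0 ip_mul_m.
have cs1 := cauchy_schwarz hE Ee Ew.
have cs2 : (\int[mu]_x (dot (e x) (m x) * psi x)) ^+ 2 <=
    L2norm (fun x => dot (e x) (m x)) ^+ 2 * \int[mu]_x (psi x ^+ 2).
  (* Cauchy-Schwarz for scalar functions, placed in the first component. *)
  pose f1 (f : R * R -> R) : field := fun x => \row_j ((j == 0)%:R * f x).
  have E1 f : L2 f -> L2field (f1 f).
    move=> f2 i; rewrite (_ : component _ i = (fun x => (i == 0)%:R * f x)).
      exact: L2_scale.
    by apply/funext => x; rewrite /component mxE.
  have ip1 f g : ip (f1 f) (f1 g) = \int[mu]_x (f x * g x).
    apply: eq_Rintegral => x _; rewrite /dot (bigD1 0)//= big1 ?addr0.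
      by rewrite !mxE eqxx !mul1r.
    by move=> j j0; rewrite !mxE (negbTE j0) !mul0r.
  have := cauchy_schwarz hE (E1 _ em) (E1 _ p2); rewrite !ip1 => h1.
  apply: le_trans h1 _; rewrite /L2norm sqr_Lnorm2; last exact: em.2.
  by under eq_Rintegral do rewrite -expr2;
    under [X in _ * X <= _]eq_Rintegral do rewrite -expr2.
have qe := ip_ge0 hE Ee; have qw := ip_ge0 hE Ew.
have := sqr_ge0 (ip e (phi - y) - \int[mu]_x (dot (e x) (m x) * psi x)).
move: cs1 cs2 yd; set a := ip e (phi - y); set b := \int[mu]_x _.
set A := \int[mu]_x _; set Q := L2norm _ ^+ 2; set p := ip e e in qe *.
set w := ip _ _ in qw *.
move=> cs1 cs2 yd ab; nra.
Qed.

End Control.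

Theorem lemma6p1 (R : realType) (m : R * R -> 'rV[R]_2)
    (m_Linfty : forall i, Linfty (component m i))
    (m_unit : {ae torus_measure, forall x, euclid (m x) = 1})
    (K_trivial : forall e, spaceK m e ->
       {ae torus_measure, forall x, e x = 0}) :
  forall eta : R, 0 < eta ->
  exists C : R, forall e : R * R -> 'rV[R]_2, spaceV e ->
    L2norm (fun x => euclid (e x)) ^+ 2 <=
      C * L2norm (fun x => dot (e x) (m x)) ^+ 2 + eta * Vnorm e ^+ 2.
Proof.
move=> eta eta0.
have [N Neta] : exists N : nat, N.+1%:R ^- 2 <= eta / 2.
  exists (Num.Def.trunc (eta / 2)^-1).
  rewrite -[leRHS]invrK lef_pV2 ?posrE ?exprn_gt0 ?invr_gt0 ?divr_gt0//.
  apply: le_trans (ltW (Num.Theory.truncnS_gt _)) _.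
  by rewrite expr2 ler_peMr// ler1n.
(* Each of the coefficients in the box is allowed 1 / (2 M) of |e|^2, with M
   larger than their number. *)
pose M : R := (size (@box N))%:R + 1.
have M0 : 0 < M by rewrite ltr_wpDl.
have /choice[C CP] k := control_pairing m_Linfty m_unit K_trivial (@vmode_L2 R k)
  (divr_gt0 (ltr0n _ 1) (mulr_gt0 (ltr0n _ 2) M0)).
exists (2 * \sum_(k <- box N) C k) => e [He Hspace]; have [Ee _] := Hspace.
rewrite L2norm_euclid//.
have low := low_frequency N He Ee.
set Q := L2norm _ ^+ 2; have Q0 : 0 <= Q by exact: sqr_ge0.
have V0 := sqr_ge0 (Vnorm e).
have qe := ip_ge0 hilbert_L2field Ee.
have modes : \sum_(k <- box N) ip e (vmode k) ^+ 2 <=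
    (\sum_(k <- box N) C k) * Q + 2^-1 * ip e e.
  apply: (@le_trans _ _ (\sum_(k <- box N) (C k * Q + 1 / (2 * M) * ip e e))).
    by apply: ler_sum => k _; exact: CP.
  rewrite big_split/= -mulr_suml lerD2l big_const_seq count_predT iter_addr_0.
  rewrite -[leLHS]mulr_natl mulrA ler_wpM2r// div1r ler_pdivrMr ?mulr_gt0//.
  rewrite /M; lra.
have tail : N.+1%:R ^- 2 * Vnorm e ^+ 2 <= eta / 2 * Vnorm e ^+ 2 by exact: ler_wpM2r.
move: (le_trans low (lerD modes tail)) => h; lra.
Qed.
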